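(* Let $N\ge1$, let $\Omega\subset\mathbb{R}^N$ be a domain, $0<T\le\infty$, and $p,q>1$. Let $(u,v)$ be a positive solution of the system $$u_t-\Delta u+v^p=0,\qquad v_t-\Delta v+u^q=0\qquad\text{in }\Omega\times(0,T).$$ Then there exist two disjoint sets $\mathcal{R}$ and $\mathcal{S}$ with $\mathcal{R}\cup\mathcal{S}=\Omega$ and $\mathcal{R}$ open, and nonnegative Radon measures $\mu_1,\mu_2$ on $\mathcal{R}$, such that: (1) for every $\psi\in C_c^0(\mathcal{R})$, $$\lim_{t\to0}\int_{\mathcal{R}}u(\cdot,t)\psi=\int_{\mathcal{R}}\psi\,d\mu_1,\qquad \lim_{t\to0}\int_{\mathcal{R}}v(\cdot,t)\psi=\int_{\mathcal{R}}\psi\,d\mu_2;$$ (2) for every open set $\mathcal{U}\subset\Omega$ such that $\mathcal{U}\cap\mathcal{S}\ne\emptyset$, $$\lim_{t\to0}\int_{\mathcal{U}}\big(u(\cdot,t)+v(\cdot,t)\big)=\infty.$$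
   Context: A positive solution $(u,v)$ of the system in $\Omega\times(0,T)$ is a couple of positive functions with $u\in L^q_{loc}(\Omega\times(0,T))$, $v\in L^p_{loc}(\Omega\times(0,T))$ such that for every $\varphi\in\mathcal{D}(\Omega\times(0,T))=C_c^\infty(\Omega\times(0,T))$, $$\iint_{\Omega\times(0,T)}(-u\varphi_t-u\Delta\varphi+v^p\varphi)=0,\qquad \iint_{\Omega\times(0,T)}(-v\varphi_t-v\Delta\varphi+u^q\varphi)=0.$$ By standard regularity for the heat equation such $u,v$ are identified with their $C^\infty(\Omega\times(0,T))$ representatives, which are positive everywhere. $C_c^0(\mathcal{R})$ is the set of continuous functions with compact support in $\mathcal{R}$. *)

(* Defs.v *)
From HB Require Import structures.
From mathcomp Require Import all_boot all_order all_algebra.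
From mathcomp Require Import all_classical all_reals all_analysis measurable_realfun.
Set Implicit Arguments.
Unset Strict Implicit.
Unset Printing Implicit Defensive.
Import Order.TTheory GRing.Theory Num.Theory.
Import numFieldNormedType.Exports.
Local Open Scope classical_set_scope.
Local Open Scope ring_scope.

(* R^n is 'rV[R]_n. Its library norm is the sup norm, which is used here only
   through the topology it induces. The library has no sigma-algebra on
   matrices: row vectors get their Borel sets. *)
Section borel_rV.
Context {R : realType} {n : nat}.

Let borel : set (set 'rV[R]_n) := <<s @open 'rV[R]_n >>.

Let borel0 : borel set0. Proof. exact: sigma_algebra0. Qed.

Let borelC A : borel A -> borel (~` A). Proof. exact: sigma_algebraC. Qed.

Let borel_bigcup (F : (set 'rV[R]_n)^nat) :
  (forall i, borel (F i)) -> borel (\bigcup_i F i).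
Proof. exact: sigma_algebra_bigcup. Qed.

HB.instance Definition _ := @isMeasurable.Build
  default_measure_display 'rV[R]_n borel borel0 borelC borel_bigcup.

Lemma open_measurable_rV (A : set 'rV[R]_n) : open A -> measurable A.
Proof. exact: sub_sigma_algebra. Qed.

Lemma measurable_coord_rV (i : 'I_n) :
  measurable_fun setT (fun x : 'rV[R]_n => x ord0 i).
Proof.
apply: (measurability _ (RGenOpens.measurableE R)).
move=> _ [_ [a [b ->]] <-]; rewrite setTI; apply: open_measurable_rV.
apply: open_comp; last exact: interval_open.
by move=> x _; exact: coord_continuous.
Qed.

Lemma open_bigcup_rat_ball (U : set 'rV[R]_n) : open U ->
  U = \bigcup_(k : 'rV[rat]_n * rat)
    [set x | ball (map_mx ratr k.1 : 'rV[R]_n) (ratr k.2) `<=` U /\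
             ball (map_mx ratr k.1 : 'rV[R]_n) (ratr k.2) x].
Proof.
move=> oU; apply/seteqP; split=> [x Ux|x [k _ [kU /kU]]//].
have [e /= e0 eU] : nbhs_ball x U by rewrite nbhs_ballE; exact: open_nbhs_nbhs.
have [r /andP[r0 re]] : exists r : rat, (0 < ratr r :> R) && (ratr r < e / 2).
  have [r] := rat_in_itvoo (divr_gt0 e0 (ltr0n R 2)).
  by rewrite in_itv; exists r.
have /choice[c cP] (i : 'I_n) : exists q : rat, `|x ord0 i - ratr q| < ratr r.
  have [q] := rat_in_itvoo (ltr_pwDr r0 (lexx (x ord0 i))).
  rewrite in_itv/= => /andP[xq qx]; exists q.
  by rewrite ltr_distlC (lt_trans _ xq) ?ltrBlDr ?ltrDl //= qx.
have kx : ball (map_mx ratr (\row_i c i) : 'rV[R]_n) (ratr r) x.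
  split=> // i j; rewrite !mxE [i]ord1 /ball/= distrC; exact: cP.
exists (\row_i c i, r) => //; split => //= y ky; apply: eU.
apply: le_ball (ball_triangle (ball_sym kx) ky).
by rewrite [leRHS]splitr lerD // ltW.
Qed.

Lemma measurable_fun_rVP d (T : measurableType d) (f : T -> 'rV[R]_n) :
  (forall i, measurable_fun setT (fun t => f t ord0 i)) ->
  measurable_fun setT f.
Proof.
move=> mf; have bE : @measurable _ 'rV[R]_n = <<s @open 'rV[R]_n >> by [].
apply: (measurability _ bE) => _ [U oU <-]; rewrite setTI.
rewrite (open_bigcup_rat_ball oU) preimage_bigcup.
apply: countable_bigcupT_measurable => [|k]; first exact: countableP.
have [kU|kU] := pselect (ball (map_mx ratr k.1 : 'rV[R]_n) (ratr k.2) `<=` U);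
  last by rewrite (_ : _ @^-1` _ = set0) // -subset0 => t [].
have [r0|r0] := ltP (0 : R) (ratr k.2); last first.
  by rewrite (_ : _ @^-1` _ = set0) // -subset0 => t [_ []]; rewrite ltNge r0.
rewrite (_ : _ @^-1` _ = \bigcap_i
    (fun t => f t ord0 i) @^-1` ball (ratr (k.1 ord0 i) : R) (ratr k.2)).
  apply: fin_bigcap_measurable => // i _; rewrite -[X in measurable X]setTI.
  by apply: mf => //; exact: measurable_ball.
apply/seteqP; split=> t /= => [[_ [_ kt]] i _|kt].
  by have := kt ord0 i; rewrite mxE.
by split=> //; split=> // i j; rewrite mxE [i]ord1; exact: kt.
Qed.

End borel_rV.

Section lebesgue_rV_succ.
Context {R : realType} {n : nat}.
Local Open Scope ereal_scope.

Definition cons_rV (z : R * 'rV[R]_n) : 'rV[R]_n.+1 :=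
  \row_i oapp (z.2 ord0) z.1 (unlift ord0 i).

Definition uncons_rV (x : 'rV[R]_n.+1) : R * 'rV[R]_n :=
  (x ord0 ord0, \row_i x ord0 (lift ord0 i)).

Lemma cons_rVK : cancel cons_rV uncons_rV.
Proof.
move=> [a x]; rewrite /uncons_rV mxE unlift_none; congr (_, _).
by apply/rowP => i; rewrite !mxE liftK.
Qed.

Lemma measurable_cons_rV : measurable_fun setT cons_rV.
Proof.
apply: measurable_fun_rVP => i.
under eq_fun do rewrite mxE.
case: unliftP => [j _|_] /=; last exact: measurable_fst.
exact: (measurableT_comp (measurable_coord_rV j) measurable_snd).
Qed.

Lemma measurable_uncons_rV : measurable_fun setT uncons_rV.
Proof.
apply: measurable_fun_pair; first exact: measurable_coord_rV.
apply: measurable_fun_rVP => i.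
by under eq_fun do rewrite mxE; exact: measurable_coord_rV.
Qed.

Variable m : {sigma_finite_measure set 'rV[R]_n -> \bar R}.

Definition lebesgue_rV_succ : set 'rV[R]_n.+1 -> \bar R :=
  pushforward (lebesgue_measure \x m) cons_rV.

Let succ0 : lebesgue_rV_succ set0 = 0.
Proof. by rewrite /lebesgue_rV_succ /pushforward preimage_set0 measure0. Qed.

Let succ_ge0 A : 0 <= lebesgue_rV_succ A.
Proof. exact: (measure_ge0 (lebesgue_measure \x m)). Qed.

Let succ_sigma_additive : semi_sigma_additive lebesgue_rV_succ.
Proof. exact: (@measure_semi_sigma_additive _ _ _
  (measure_function_pushforward__canonical__measure_function_Measure
    (lebesgue_measure \x m) measurable_cons_rV)). Qed.

HB.instance Definition _ := isMeasure.Build _ _ _ lebesgue_rV_succ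
  succ0 succ_ge0 succ_sigma_additive.

Let succ_sigma_finite : sigma_finite setT lebesgue_rV_succ.
Proof.
have /sigma_finiteP[F [FT ndF Foo]] := sigma_finiteT (@lebesgue_measure R).
have /sigma_finiteP[G [GT ndG Goo]] := sigma_finiteT m.
exists (fun k => uncons_rV @^-1` (F k `*` G k)).
  rewrite -preimage_bigcup; apply/seteqP; split=> // x _.
  have [i _ Fi] : (\bigcup_i F i) (uncons_rV x).1 by rewrite -FT.
  have [j _ Gj] : (\bigcup_i G i) (uncons_rV x).2 by rewrite -GT.
  exists (maxn i j) => //; split.
    by move: Fi; apply/subsetPset/ndF/leq_maxl.
  by move: Gj; apply/subsetPset/ndG/leq_maxr.
move=> k; have [mF Fk] := Foo k; have [mG Gk] := Goo k; split.
  rewrite -[X in measurable X]setTI.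
  by apply: measurable_uncons_rV => //; exact: measurableX.
rewrite /lebesgue_rV_succ /pushforward -comp_preimage.
rewrite (_ : uncons_rV \o cons_rV = id); last by apply/funext; exact: cons_rVK.
rewrite preimage_id product_measure1E //.
by apply: lte_mul_pinfty => //; rewrite ge0_fin_numE.
Qed.

HB.instance Definition _ := Measure_isSigmaFinite.Build _ _ _ lebesgue_rV_succ
  succ_sigma_finite.

End lebesgue_rV_succ.

(* Lebesgue measure on the Borel sets of R^n, as the n-fold product of
   the one-dimensional one; see lebesgue_rV_box. *)
Fixpoint lebesgue_rV {R : realType} (n : nat) :
    {sigma_finite_measure set 'rV[R]_n -> \bar R} :=
  if n is k.+1 then lebesgue_rV_succ (lebesgue_rV k) else \d_(0 : 'rV[R]_0).

Lemma lebesgue_rV_box (R : realType) (n : nat) (A : 'I_n -> set R) :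
  (forall i, measurable (A i)) ->
  lebesgue_rV n [set x : 'rV[R]_n | forall i, A i (x ord0 i)] =
  (\prod_(i < n) lebesgue_measure (A i))%E.
Proof.
elim: n A => [|n IHn] A mA.
  by rewrite big_ord0 /= diracE mem_set // => -[].
rewrite big_ord_recl -IHn //= /lebesgue_rV_succ /pushforward.
rewrite -product_measure1E; [|exact: mA|]; last first.
  rewrite (_ : mkset _ = \bigcap_i
    (fun x : 'rV[R]_n => x ord0 i) @^-1` A (lift ord0 i)).
    apply: fin_bigcap_measurable => // i _; rewrite -[X in measurable X]setTI.
    exact: measurable_coord_rV.
  by apply/seteqP; split=> x /= Ax i; [move=> _|]; exact: Ax.
congr (product_measure1 _ _ _); apply/seteqP; split=> -[a x] /=.
  move=> Aax; split=> [|i].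
    by have := Aax ord0; rewrite mxE unlift_none.
  by have := Aax (lift ord0 i); rewrite mxE liftK.
by move=> [Aa Ax] i; rewrite mxE; case: unliftP => [j ->|->].
Qed.

Section function_spaces.
Context {R : realType}.

(* f is k times continuously differentiable on the open set W. *)
Fixpoint Ck_on (V : normedModType R) (W : set V) (k : nat) (f : V -> R) :=
  if k is l.+1 then
    (forall x, W x -> differentiable f x) /\
    (forall v, Ck_on W l (fun x => 'D_v f x))
  else forall x, W x -> {for x, continuous f}.

Definition smooth_on (V : normedModType R) (W : set V) (f : V -> R) :=
  forall k, Ck_on W k f.

Definition compact_support_in (V : topologicalType) (W : set V) (f : V -> R) :=
  compact (closure [set x | f x != 0]) /\ closure [set x | f x != 0] `<=` W.

(* Elements of C_c^oo(W) and C_c^0(W), W open, are extended by 0 outside W. *)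
Definition test_function (V : normedModType R) (W : set V) (f : V -> R) :=
  smooth_on setT f /\ compact_support_in W f.

Definition Cc0 (V : topologicalType) (W : set V) (f : V -> R) :=
  continuous f /\ compact_support_in W f.

End function_spaces.

Section heat_system.
Context {R : realType} {N : nat}.

Definition domain (Omega : set 'rV[R]_N) :=
  [/\ open Omega, connected Omega & Omega !=set0].

Definition cylinder (Omega : set 'rV[R]_N) (T : \bar R) :
    set ('rV[R]_N * R) :=
  [set z | Omega z.1 /\ 0 < z.2 /\ (z.2%:E < T)%E].

(* measurableTypeR R is R with the measurable structure carried by the
   library's lebesgue_measure. *)
Definition spacetime_measure :
    set ('rV[R]_N * measurableTypeR R) -> \bar R :=
  (lebesgue_rV N \x lebesgue_measure)%E.

HB.instance Definition _ := Measure.on spacetime_measure.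

Definition dt (f : 'rV[R]_N * R -> R) : 'rV[R]_N * R -> R :=
  fun z => 'D_(0, 1) f z.

Definition dx (i : 'I_N) (f : 'rV[R]_N * R -> R) : 'rV[R]_N * R -> R :=
  fun z => 'D_(delta_mx 0 i, 0) f z.

Definition laplacian (f : 'rV[R]_N * R -> R) : 'rV[R]_N * R -> R :=
  fun z => \sum_(i < N) dx i (dx i f) z.

Definition Lloc (r : R) (Q : set ('rV[R]_N * R)) (f : 'rV[R]_N * R -> R) :=
  measurable_fun (Q : set ('rV[R]_N * measurableTypeR R)) f /\
  forall K, compact K -> K `<=` Q ->
    (\int[spacetime_measure]_(z in K) (`|f z| `^ r)%:E < +oo)%E.

Definition positive_solution (p q : R) (Q : set ('rV[R]_N * R))
    (u v : 'rV[R]_N * R -> R) :=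
  [/\ forall z, Q z -> 0 < u z,
      forall z, Q z -> 0 < v z,
      Lloc q Q u,
      Lloc p Q v &
      forall phi, test_function Q phi ->
        (\int[spacetime_measure]_(z in Q)
           (- (u z * dt phi z) - u z * laplacian phi z
            + v z `^ p * phi z)%:E = 0)%E /\
        (\int[spacetime_measure]_(z in Q)
           (- (v z * dt phi z) - v z * laplacian phi z
            + u z `^ q * phi z)%:E = 0)%E].

(* Borel measures on the open set U are represented by Borel measures on R^N
   for which the complement of U is null. *)
Definition radon_on (U : set 'rV[R]_N)
    (mu : {measure set 'rV[R]_N -> \bar R}) :=
  [/\ mu (~` U) = 0%E,
      forall K, compact K -> K `<=` U -> (mu K < +oo)%E,
      forall A, measurable A -> A `<=` U ->
        mu A = ereal_inf [set mu V | V in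
                 [set V | open V /\ A `<=` V /\ V `<=` U]] &
      forall V, open V -> V `<=` U ->
        mu V = ereal_sup [set mu K | K in
                 [set K | compact K /\ K `<=` V]]].

End heat_system.

(* Main.v *)
Require Import Defs.
From HB Require Import structures.
From mathcomp Require Import all_boot all_order all_algebra.
From mathcomp Require Import all_classical all_reals all_analysis.
From mathcomp Require Import measurable_realfun ring lra.
Import Order.TTheory GRing.Theory Num.Theory.
Import numFieldNormedType.Exports.
Set Implicit Arguments.
Unset Strict Implicit.
Unset Printing Implicit Defensive.
Local Open Scope classical_set_scope.
Local Open Scope ring_scope.

(** The singular set consists of the points all of whose neighbourhoods carry a
    total mass, the integral of [u + v], tending to infinity as [t] tends to 0.
    With this choice the regular set is open and the blow-up statement is
    immediate; what has to be proved is that both solutions have a trace on the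
    regular set.

    Let [x0] be regular, let [psi] be a cutoff supported in a neighbourhood of
    [x0] in which the mass does not tend to infinity, and let [g] be a high
    power of [psi]. Since the Laplacian of [psi ^+ k.+2] is bounded by a multiple
    of [psi ^+ k], the absorption terms [u^q g] and [v^p g] dominate the
    diffusion terms up to a constant as soon as [k] is large in terms of [p] and
    [q] ([absorb_linear], [laplacian_pow_bound]). Hence the weighted mass [G],
    the integral of [(u + v) g], satisfies [G' <= C]. It therefore stays bounded as
    [t] tends to 0, because it is bounded along a sequence of times, and it has
    a limit, because [G t - C t] is nonincreasing. If [phi] is a test function
    supported where [psi = 1], then a large multiple of [G] plus the integral of
    [u phi] satisfies an inequality of the same type ([key_monotone]): the extra
    absorption in [G] pays for all terms that contain [phi]. So this sum
    converges as well, and so does the integral of [u phi]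
    ([regular_point_limit]).

    These differential inequalities hold in the sense of distributions in time:
    they come from testing with products [phi x * eta t] and Fubini's theorem.
    The masses are continuous in time, and for a continuous function such an
    inequality can be integrated ([weak_derivative_le]).

    Passing from smooth to continuous test functions is a density argument: the
    masses are controlled by the convergent mass of one plateau function, and
    continuous functions are approximated uniformly by combinations of lattice
    bumps ([smooth_approx], [mass_limit_Cc0]). The limits form a positive linear
    functional on the continuous functions with compact support in the regular
    set, which [riesz_representation] turns into the two Radon measures. *)

(** * Calculus of smooth functions *)

Section smooth_calculus.
Context {R : realType} {V : normedModType R}.
Implicit Types (f g : V -> R) (k : nat).

Lemma CkS_on (W : set V) k f : Ck_on W k.+1 f -> Ck_on W k f.
Proof.
elim: k f => [|k IH] f /= [df Df].
  by move=> x Wx; exact/differentiable_continuous/df.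
by split=> // v; apply: IH; exact: Df.
Qed.

Lemma Ck_cst k (a : R) : Ck_on setT k (fun _ : V => a).
Proof.
elim: k a => [|k IH] a /=; first by move=> x _; exact: cst_continuous.
split=> [x _|v]; first exact: differentiable_cst.
rewrite [X in Ck_on _ _ X](_ : _ = fun _ => 0); first exact: IH.
by apply/funext => x; rewrite derive_cst.
Qed.

Lemma CkD k f g : Ck_on setT k f -> Ck_on setT k g ->
  Ck_on setT k (fun x => f x + g x).
Proof.
elim: k f g => [|k IH] f g /=.
  by move=> cf cg x _; apply: continuousD; [exact: cf|exact: cg].
move=> [df Df] [dg Dg]; split=> [x _|v].
  by apply: differentiableD; [exact: df|exact: dg].
rewrite [X in Ck_on _ _ X](_ : _ = fun x => 'D_v f x + 'D_v g x).
  by apply: IH; [exact: Df|exact: Dg].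
apply/funext => x; rewrite -deriveD //; apply: diff_derivable;
  [exact: df|exact: dg].
Qed.

Lemma CkM k f g : Ck_on setT k f -> Ck_on setT k g ->
  Ck_on setT k (fun x => f x * g x).
Proof.
elim: k f g => [|k IH] f g.
  by move=> cf cg x _; apply: continuousM; [exact: cf|exact: cg].
move=> Cf Cg; move: (Cf) (Cg) => [df Df] [dg Dg]; split=> [x _|v].
  by apply: differentiableM; [exact: df|exact: dg].
rewrite [X in Ck_on _ _ X](_ : _ = fun x => f x * 'D_v g x + g x * 'D_v f x).
  by apply: CkD; apply: IH;
     [exact: CkS_on|exact: Dg|exact: CkS_on|exact: Df].
apply/funext => x; rewrite [LHS]deriveM //; apply: diff_derivable;
  [exact: df|exact: dg].
Qed.

Lemma CkV k f : (forall x, f x != 0) -> Ck_on setT k f ->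
  Ck_on setT k (fun x => (f x)^-1).
Proof.
move=> f0; elim: k => [|k IH].
  by move=> cf x _; apply: continuousV; [exact: f0|exact: cf].
move=> Cf; move: (Cf) => [df Df]; split=> [x _|v].
  by apply: differentiableV; [exact: df|exact: f0].
rewrite [X in Ck_on _ _ X](_ : _ =
    fun x => (-1) * ((f x)^-1 * (f x)^-1 * 'D_v f x)).
  have Cf' := IH (CkS_on Cf).
  by apply: CkM; [exact: Ck_cst|apply: CkM; [exact: CkM|exact: Df]].
apply/funext => x; rewrite [LHS]deriveV //; last first.
  by apply: diff_derivable; exact: df.
by rewrite -exprVn mulN1r /GRing.scale /= mulNr expr2.
Qed.

Lemma smooth_cst (a : R) : smooth_on setT (fun _ : V => a).
Proof. by move=> k; exact: Ck_cst. Qed.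

Lemma smoothD f g : smooth_on setT f -> smooth_on setT g ->
  smooth_on setT (fun x => f x + g x).
Proof. by move=> sf sg k; apply: CkD. Qed.

Lemma smoothM f g : smooth_on setT f -> smooth_on setT g ->
  smooth_on setT (fun x => f x * g x).
Proof. by move=> sf sg k; apply: CkM. Qed.

Lemma smoothZ a f : smooth_on setT f -> smooth_on setT (fun x => a * f x).
Proof. by move=> sf; apply: smoothM => //; exact: smooth_cst. Qed.

Lemma smoothB f g : smooth_on setT f -> smooth_on setT g ->
  smooth_on setT (fun x => f x - g x).
Proof.
move=> sf sg; rewrite [X in smooth_on _ X](_ : _ = fun x => f x + (-1) * g x).
  by apply: smoothD => //; exact: smoothZ.
by apply/funext => x; rewrite mulN1r.
Qed.

Lemma smoothV f : (forall x, f x != 0) -> smooth_on setT f ->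
  smooth_on setT (fun x => (f x)^-1).
Proof. by move=> f0 sf k; apply: CkV. Qed.

Lemma smoothX m f : smooth_on setT f -> smooth_on setT (fun x => f x ^+ m).
Proof.
move=> sf; elim: m => [|m IH]; first exact: smooth_cst.
rewrite [X in smooth_on _ X](_ : _ = fun x => f x * f x ^+ m);
  first exact: smoothM.
by apply/funext => x; rewrite exprS.
Qed.

Lemma smooth_prod (I : Type) (s : seq I) (F : I -> V -> R) :
  (forall i, smooth_on setT (F i)) ->
  smooth_on setT (fun x => \prod_(i <- s) F i x).
Proof.
move=> sF; elim: s => [|i s IH].
  by rewrite [X in smooth_on _ X](_ : _ = fun=> 1);
    [exact: smooth_cst|apply/funext => x; rewrite big_nil].
rewrite [X in smooth_on _ X](_ : _ = fun x => F i x * \prod_(j <- s) F j x).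
  exact: smoothM.
by apply/funext => x; rewrite big_cons.
Qed.

Lemma smooth_differentiable f x : smooth_on setT f -> differentiable f x.
Proof. by move=> /(_ 1%N) [+ _]; apply. Qed.

Lemma smooth_derivable f x v : smooth_on setT f -> derivable f x v.
Proof. by move=> sf; exact/diff_derivable/smooth_differentiable. Qed.

Lemma smooth_continuous f : smooth_on setT f -> continuous f.
Proof. by move=> /(_ 0%N) cf x; exact: cf. Qed.

Lemma smooth_derive f v : smooth_on setT f -> smooth_on setT ('D_v f).
Proof. by move=> sf k; have [_] := sf k.+1; apply. Qed.

End smooth_calculus.

(** Precomposition with an affine map covers coordinate projections, the two
    projections of space-time and all translations and dilations. *)
Section smooth_affine.
Context {R : realType} {V V' : normedModType R}.
Variables (L0 : V -> V') (c : V').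
Hypotheses (linL : linear L0) (cL : continuous L0).

Let L : {linear V -> V'} := HB.pack L0 (GRing.isLinear.Build _ _ _ _ L0 linL).

Let g z := L z + c.

Let dg z : differentiable g z.
Proof.
by apply: differentiableD;
  [exact: linear_differentiable|exact: differentiable_cst].
Qed.

Let diffg z : 'd g z = L :> (V -> V').
Proof.
rewrite diffD; [|exact: linear_differentiable|exact: differentiable_cst].
by rewrite diff_lin // diff_cst; apply/funext => v /=; rewrite addr0.
Qed.

Lemma derive_affine (f : V' -> R) z v : differentiable f (L0 z + c) ->
  'D_v (fun x => f (L0 x + c)) z = 'D_(L0 v) f (L0 z + c).
Proof.
move=> df; rewrite !deriveE //; last exact: (@differentiable_comp _ _ _ _ g).
by rewrite (@diff_comp _ _ _ _ g f z (dg z) df) /= diffg.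
Qed.

Lemma smooth_affine (f : V' -> R) : smooth_on setT f ->
  smooth_on setT (fun x => f (L0 x + c)).
Proof.
move=> + k; elim: k f => [|k IH] f sf.
  move=> x _; apply: (@continuous_comp _ _ _ g f).
    exact/differentiable_continuous/dg.
  exact: smooth_continuous.
split=> [x _|v].
  apply: (@differentiable_comp _ _ _ _ g) => //.
  exact: smooth_differentiable.
rewrite [X in Ck_on _ _ X](_ : _ = fun x => 'D_(L0 v) f (L0 x + c)).
  by apply: (IH ('D_(L0 v) f)); exact: smooth_derive.
by apply/funext => x; rewrite derive_affine //; exact: smooth_differentiable.
Qed.

End smooth_affine.

(** * A smooth step and compactly supported bumps *)

Section smooth_step.
Context {R : realType}.
Implicit Types (x : R) (n : nat).

(** The functions [x^-n * exp(-1/x)], extended by 0, are closed under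
    differentiation up to linear combinations, which makes the smoothness of
    all of them a single induction. *)
Definition flat n x : R := if 0 < x then x^-1 ^+ n * expR (- x^-1) else 0.

Lemma flat_ge0 n x : 0 <= flat n x.
Proof.
rewrite /flat; case: ifPn => // x0.
by rewrite mulr_ge0 ?expR_ge0 // exprn_ge0 // invr_ge0 ltW.
Qed.

Lemma flat_le0 n x : x <= 0 -> flat n x = 0.
Proof. by rewrite /flat ltNge => ->. Qed.

Lemma flat_gt0 n x : 0 < x -> 0 < flat n x.
Proof.
by move=> x0; rewrite /flat x0 mulr_gt0 ?expR_gt0 // exprn_gt0 // invr_gt0.
Qed.

(** This is what makes the difference quotients at 0 converge to 0. *)
Lemma flat_bound n x : flat n x <= n.+1`!%:R * `|x|.
Proof.
rewrite /flat; case: ifPn => [x0|_]; last by rewrite mulr_ge0.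
have y0 : 0 < x^-1 by rewrite invr_gt0.
rewrite gtr0_norm // expRN ler_pdivrMr ?expR_gt0 //.
have := expR_ge1Dxn n (ltW y0); move: (expR _) => e yb.
have {yb} : x^-1 ^+ n.+1 / n.+1`!%:R <= e by apply: le_trans yb; rewrite lerDr.
rewrite ler_pdivrMr ?ltr0n ?fact_gt0 // exprS ler_pdivrMl //.
move=> h; apply: le_trans h _; rewrite le_eqVlt; apply/orP; left; apply/eqP.
by ring.
Qed.

Lemma flat_le x y : x <= y -> flat 0 x <= flat 0 y.
Proof.
move=> xy; have [x0|x0] := ltP 0 x; last by rewrite flat_le0 // flat_ge0.
have y0 := lt_le_trans x0 xy.
rewrite /flat x0 y0 !expr0 !mul1r ler_expR lerN2 lef_pV2 //.
Qed.

Lemma is_derive_flat n x :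
  is_derive x 1 (flat n) (flat n.+2 x - n%:R * flat n.+1 x).
Proof.
have [x0|x0|<-] := ltgtP 0 x.
- have xn0 : x != 0 by rewrite gt_eqF.
  apply: (near_eq_is_derive (f :=
    fun y : R => y^-1 ^+ n * expR (- y^-1))).
    near=> y; rewrite /flat ifT //.
    by near: y; exact: lt_nbhsr.
  have dV : is_derive x (1 : R) (fun y : R => y^-1) (- x ^- 2).
    rewrite -[- _]mulr1; apply: DeriveDef; first exact: derivableV.
    by rewrite deriveV // derive_id.
  have dX := is_deriveX n dV.
  have dE : is_derive x (1 : R) (fun y => expR (- y^-1))
      (expR (- x^-1) * x ^- 2).
    apply: (@is_derive1_comp _ expR (fun y => - y^-1) x).
    by rewrite -[x ^- 2]opprK; exact: is_deriveN.
  have D := is_deriveM dX dE; rewrite exprfctE in D; apply: (is_derive_eq D).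
  rewrite /flat x0 /GRing.scale /=.
  set e := expR _; have -> : x ^- 2 = x^-1 ^+ 2 by rewrite exprVn.
  case: n dX D => [|n] _ _ /=; first by rewrite !mul0r mulr0 addr0 subr0; ring.
  by rewrite !exprS; ring.
- rewrite !flat_le0 ?(ltW x0) // mulr0 subr0.
  apply: (near_eq_is_derive (f := cst (0 : R))).
    near=> y; rewrite flat_le0 //=; apply: ltW.
    by near: y; exact: lt_nbhsl.
- rewrite !flat_le0 // mulr0 subr0.
  have H : (fun h : R =>
      h^-1 *: ((flat n \o shift 0) (h *: (1 : R)) - flat n 0)) @ 0^' -->
        (0 : R).
    apply/cvgr0Pnorm_le => e e0; near=> h.
    have h0 : h != 0 by near: h; exact: nbhs_dnbhs_neq.
    rewrite /= addr0 (@flat_le0 n 0) // subr0 /GRing.scale /= mulr1.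
    have -> : h^-1 * flat n h = flat n.+1 h.
      by rewrite /flat; case: ifP; rewrite ?mulr0 // exprS mulrA.
    rewrite ger0_norm ?flat_ge0 //; apply: le_trans (flat_bound _ _) _.
    rewrite mulrC -ler_pdivlMr ?ltr0n ?fact_gt0 //.
    near: h; apply: dnbhs0_le.
    by rewrite divr_gt0 // ltr0n fact_gt0.
  apply: DeriveDef; last exact: cvg_lim H.
  by apply/cvg_ex; exists 0.
Unshelve. all: by end_near. Qed.

Lemma derive_scalar (f : R -> R) x (v : R) : differentiable f x ->
  'D_v f x = v * 'D_1 f x.
Proof.
move=> df; rewrite !deriveE // -[X in 'd f x X]mulr1.
by rewrite -[v * 1]/(v *: 1) linearZ.
Qed.

Lemma smooth_flat n : smooth_on setT (flat n).
Proof.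
move=> k; elim: k n => [|k IH] n.
  move=> x _; apply/differentiable_continuous/derivable1_diffP.
  by case: (is_derive_flat n x).
have df x : differentiable (flat n) x.
  by apply/derivable1_diffP; case: (is_derive_flat n x).
split=> [//|v]; rewrite [X in Ck_on _ _ X](_ : _ =
    fun x => v * (flat n.+2 x + (- n%:R) * flat n.+1 x)).
  by apply: CkM; [exact: Ck_cst|apply: CkD => //; apply: CkM => //;
     exact: Ck_cst].
apply/funext => x; rewrite derive_scalar // mulNr.
by have [_ ->] := is_derive_flat n x.
Qed.

Definition step x : R := flat 0 x / (flat 0 x + flat 0 (1 - x)).

Let den_gt0 x : 0 < flat 0 x + flat 0 (1 - x).
Proof.
have [x0|x0] := ltP 0 x; first by rewrite ltr_pwDl ?flat_gt0 ?flat_ge0.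
by rewrite ltr_wpDl ?flat_ge0 // flat_gt0 // subr_gt0 (le_lt_trans x0).
Qed.

Lemma step_le0 x : x <= 0 -> step x = 0.
Proof. by move=> x0; rewrite /step flat_le0 // mul0r. Qed.

Lemma step_ge1 x : 1 <= x -> step x = 1.
Proof.
move=> x1; rewrite /step (@flat_le0 0 (1 - x)) ?subr_le0 // addr0 divff //.
by rewrite gt_eqF // flat_gt0 // (lt_le_trans ltr01).
Qed.

Lemma step_le x y : x <= y -> step x <= step y.
Proof.
move=> xy; rewrite /step ler_pdivrMr ?den_gt0 // mulrAC ler_pdivlMr ?den_gt0 //.
rewrite !mulrDr mulrC lerD2l ler_pM ?flat_ge0 ?flat_le //.
by rewrite lerD2l lerN2.
Qed.

Lemma step_ge0 x : 0 <= step x.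
Proof. by rewrite /step divr_ge0 ?flat_ge0 // ltW. Qed.

Lemma step_le1 x : step x <= 1.
Proof. by rewrite /step ler_pdivrMr ?den_gt0 // mul1r lerDl flat_ge0. Qed.

Let linear_mulr (a : R) : linear ( *%R a : R -> R).
Proof. by move=> k x y; rewrite /GRing.scale /=; ring. Qed.

Let continuous_mulr (a : R) : continuous ( *%R a : R -> R).
Proof. by move=> x; apply: continuousM; [exact: cst_continuous|]. Qed.

Lemma smooth_rescale (f : R -> R) a b : smooth_on setT f ->
  smooth_on setT (fun x => f (a * x + b)).
Proof.
by move=> sf; exact: (smooth_affine b (linear_mulr a) (@continuous_mulr a) sf).
Qed.

Lemma derive_rescale (f : R -> R) a b x : smooth_on setT f ->
  'D_1 (fun x => f (a * x + b)) x = a * 'D_1 f (a * x + b).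
Proof.
move=> sf; have df := smooth_differentiable _ sf.
rewrite (@derive_affine _ _ _ _ b (linear_mulr a) (@continuous_mulr a) f x 1
  (df _)).
by rewrite mulr1 derive_scalar.
Qed.

Lemma smooth_step : smooth_on setT step.
Proof.
apply: smoothM; first exact: smooth_flat.
apply: smoothV => [x|]; first by rewrite gt_eqF.
apply: smoothD; first exact: smooth_flat.
rewrite [X in smooth_on _ X](_ : _ = fun x => flat 0 (-1 * x + 1)).
  exact/smooth_rescale/smooth_flat.
by apply/funext => x; rewrite mulN1r addrC.
Qed.

Lemma derive_step_ge0 x : 0 <= 'D_1 step x.
Proof.
have ds y : derivable step y 1 by exact/smooth_derivable/smooth_step.
rewrite /derive; apply: limr_ge; first exact: ds.
near=> h; rewrite /GRing.scale /= mulr1.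
have h0 : h != 0 by near: h; exact: nbhs_dnbhs_neq.
have [{}h0|{}h0|/eqP] := ltgtP h 0; last by rewrite (negbTE h0).
  rewrite mulr_le0 // ?invr_le0 ?(ltW h0) // subr_le0 step_le //.
  by rewrite gerDr ltW.
by rewrite mulr_ge0 // ?invr_ge0 ?(ltW h0) // subr_ge0 step_le // lerDr ltW.
Unshelve. all: by end_near. Qed.

End smooth_step.

(** Being a difference of two shifted steps, it has integer translates that
    telescope to 1. *)
Section plateau.
Context {R : realType}.
Implicit Types s : R.

Definition plateau s : R := step (s + 1) - step s.

Lemma plateau_ge0 s : 0 <= plateau s.
Proof. by rewrite subr_ge0 step_le // lerDl. Qed.

Lemma plateau_eq0 s : 1 <= `|s| -> plateau s = 0.
Proof.
rewrite /plateau; case: (ler0P s) => s0 s1.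
  by rewrite !step_le0 ?subr0 //; lra.
by rewrite !step_ge1 ?subrr //; lra.
Qed.

Lemma smooth_plateau : smooth_on setT plateau.
Proof.
apply: smoothB; last exact: smooth_step.
rewrite [X in smooth_on _ X](_ : _ = fun s => step (1 * s + 1)).
  exact/smooth_rescale/smooth_step.
by apply/funext => s; rewrite mul1r.
Qed.

Lemma sum_plateau (M : nat) s : `|s| <= M%:R ->
  \sum_(j < M.*2.+1) plateau (s - (j%:R - M%:R)) = 1.
Proof.
rewrite ler_norml => /andP[s1 s2].
pose F j := - step (s + M%:R + 1 - j%:R).
rewrite (eq_bigr (fun j : 'I_(M.*2.+1) => F j.+1 - F j)); last first.
  move=> j _; rewrite /plateau /F -natr1 opprK [RHS]addrC.
  by congr (step _ - step _); ring.
rewrite -(big_mkord xpredT (fun j => F j.+1 - F j)) telescope_sumr //.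
rewrite /F opprK subr0 step_le0 ?step_ge1; [by rewrite oppr0 add0r|lra|].
by rewrite -natr1 -addnn natrD; lra.
Qed.

End plateau.

Section box_bump.
Context {R : realType} {N : nat}.
Implicit Types (a y : 'rV[R]_N) (h : R).

Definition box_bump h a y : R :=
  \prod_(i < N) plateau (h^-1 * (y ord0 i - a ord0 i)).

Lemma box_bump_ge0 h a y : 0 <= box_bump h a y.
Proof. by apply: prodr_ge0 => i _; exact: plateau_ge0. Qed.

Lemma ler_norm_rV (y : 'rV[R]_N) (r : R) : 0 <= r ->
  (`|y| <= r) <-> (forall i, `|y ord0 i| <= r).
Proof.
move=> r0; split=> [yr i|yr].
  apply: le_trans yr; rewrite /Num.Def.normr /= mx_normrE.
  exact: (le_bigmax _ (fun p => `|y p.1 p.2|) (ord0, i)).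
rewrite /Num.Def.normr /= mx_normrE; apply: bigmax_le => // -[j i] _ /=.
by rewrite [j]ord1.
Qed.

Lemma box_bump_neq0 h a y : 0 < h -> box_bump h a y != 0 -> `|y - a| <= h.
Proof.
move=> h0 b0; rewrite ler_norm_rV ?(ltW h0) // => i.
rewrite !mxE leNgt; apply: contra b0 => hi.
rewrite /box_bump (bigD1 i) //= plateau_eq0 ?mul0r //.
by rewrite normrM gtr0_norm ?invr_gt0 // mulrC ler_pdivlMr // mul1r ltW.
Qed.

Lemma smooth_box_bump h a : smooth_on setT (box_bump h a).
Proof.
apply: smooth_prod => i; pose c := - (h^-1 * a ord0 i).
pose L (y : 'rV[R]_N) : R := h^-1 * y ord0 i.
have linL : linear L by move=> k x y; rewrite /L !mxE /GRing.scale /=; ring.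
have cL : continuous L.
  move=> y; apply: (@continuousM _ _ (fun=> h^-1)
    (fun z : 'rV[R]_N => z ord0 i)).
    exact: cst_continuous.
  exact: coord_continuous.
rewrite [X in smooth_on _ X](_ : _ = fun y => plateau (L y + c)).
  exact: (smooth_affine c linL cL smooth_plateau).
by apply/funext => y; rewrite /L /c mulrBr.
Qed.

End box_bump.

(** * Compactness, Borel measures and partitions of unity on row vectors *)

Section topology_toolbox.
Context {R : realType}.

(** For an arbitrary hereditary property of sets instead of an open cover: the
    properties used below are being contained in an open set, having a small
    oscillation, and supporting only functions whose masses converge. *)
Lemma lebesgue_number (V : normedModType R) (K : set V) (P : set V -> Prop) :
  compact K -> (forall A B, A `<=` B -> P B -> P A) ->
  (forall x, K x -> exists2 r, 0 < r & P (ball x r)) ->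
  exists2 h : R, 0 < h & forall y, K y -> P (ball y h).
Proof.
move=> /compact_near_coveringP cK PS KP.
have [] := cK R (0 : R)^'+ (fun h y => P (ball y h)).
  move=> x Kx; have [r r0 Pr] := KP x Kx;
    have r20 : 0 < r / 2 by rewrite divr_gt0.
  near=> y h; apply: PS Pr => z yz.
  have hr : h <= r / 2 by near: h; exact: nbhs_right_le.
  have xy : ball x (r / 2) y by near: y; exact: nbhsx_ballx.
  rewrite [r]splitr; apply: ball_triangle xy _.
  exact: le_ball yz.
move=> e /= e0 He; exists (e / 2); first by rewrite divr_gt0.
apply: He; last by rewrite /= divr_gt0.
by rewrite /ball /= sub0r normrN gtr0_norm ?divr_gt0 // ltr_pdivrMr //
  ltr_pMr // ltr1n.
Unshelve. all: by end_near. Qed.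

Lemma compact_nbhs_sub (V : normedModType R) (K W : set V) :
  compact K -> open W -> K `<=` W ->
  exists2 h : R, 0 < h & forall y, K y -> ball y h `<=` W.
Proof.
move=> cK oW KW; apply: (lebesgue_number (P := fun A => A `<=` W)) => //
  [A B AB BW|x Kx].
  exact: subset_trans BW.
have : nbhs x W by apply: open_nbhs_nbhs; split => //; exact: KW.
by rewrite -nbhs_ballE => -[r /= r0 rW]; exists r.
Qed.

Lemma compact_support_sub (V : normedModType R) (K : set V) (f : V -> R) :
  compact K -> (forall x, f x != 0 -> K x) ->
  closure [set x | f x != 0] `<=` K.
Proof.
move=> cK fK; rewrite closureE; apply: smallest_sub => //.
by apply: compact_closed => //; exact: norm_hausdorff.
Qed.

Lemma compact_support_inW (V : normedModType R) (K W : set V) (f : V -> R) :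
  compact K -> K `<=` W -> (forall x, f x != 0 -> K x) ->
  compact_support_in W f.
Proof.
move=> cK KW fK; have sK := compact_support_sub cK fK.
split; last exact: subset_trans KW.
by apply: subclosed_compact sK => //; exact: closed_closure.
Qed.

(** Extension by zero: off the support of [g] the product vanishes on a whole
    neighbourhood, so that [f] matters only near that support. *)
Lemma continuous_mul_support (V : normedModType R) (W : set V) (f g : V -> R) :
  open W -> (forall x, W x -> {for x, continuous f}) -> continuous g ->
  closure [set x | g x != 0] `<=` W -> continuous (fun x => f x * g x).
Proof.
move=> oW cf cg gW x; have [Wx|Wx] := pselect (W x).
  by apply: continuousM; [exact: cf|exact: cg].
apply: (@near_cst_continuous _ _ 0).
have : nbhs x (~` closure [set x | g x != 0]).
  apply: open_nbhs_nbhs; split; last by move=> /gW.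
  exact/closed_openC/closed_closure.
apply: filterS => y gy; have -> : g y = 0; last by rewrite mulr0.
by apply: contrapT => /eqP g0; apply/gy/subset_closure.
Qed.

Lemma compact_bound (V : normedModType R) (K : set V) (f : V -> R) :
  compact K -> {within K, continuous f} ->
  exists2 M : R, 0 < M & forall x, K x -> `|f x| <= M.
Proof.
move=> cK cf; have [M [_ HM]] := compact_bounded (continuous_compact cf cK).
exists (Num.max M 0 + 1); first by rewrite ltr_wpDl // le_max lexx orbT.
move=> x Kx; apply: HM; last by exists x.
by rewrite ltr_pwDr // le_max lexx.
Qed.

End topology_toolbox.

Section row_vectors.
Context {R : realType} {N : nat}.
Implicit Types (K W : set 'rV[R]_N) (f g : 'rV[R]_N -> R).

Lemma ball_rVE (a y : 'rV[R]_N) (r : R) : ball a r y = (`|a - y| < r) :> Prop.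
Proof. by rewrite -ball_normE. Qed.

Lemma compact_ball_rV (a : 'rV[R]_N) (r : R) : 0 <= r ->
  compact [set y : 'rV[R]_N | `|y - a| <= r].
Proof.
move=> r0; rewrite [X in compact X](_ : _ = [set y : 'rV[R]_N | forall i,
  `[a ord0 i - r, a ord0 i + r]%classic (y ord0 i)]).
  apply: (@rV_compact _ _ (fun i => `[a ord0 i - r, a ord0 i + r]%classic)).
  by move=> i; exact: segment_compact.
apply/seteqP; split=> y /=; rewrite ler_norm_rV // => ya i; have := ya i;
  by rewrite !mxE ler_distl /= in_itv.
Qed.

Lemma measurable_compact_rV K : compact K -> measurable K.
Proof.
move=> cK; rewrite -[K]setCK; apply: measurableC; apply: open_measurable_rV.
by apply: closed_openC; apply: compact_closed => //; exact: norm_hausdorff.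
Qed.

Lemma open_continuous_measurable_rV W f : open W ->
  (forall x, W x -> {for x, continuous f}) -> measurable_fun W f.
Proof.
move=> oW cf; apply: (measurability _ (RGenOpens.measurableE R)).
move=> _ [_ [a [b ->]] <-]; apply: open_measurable_rV.
rewrite openE => x [Wx fx]; apply: filterI; first exact: open_nbhs_nbhs.
by apply: cf => //; apply: open_nbhs_nbhs; split => //; exact: interval_open.
Qed.

Lemma continuous_measurable_rV f : continuous f -> measurable_fun setT f.
Proof.
move=> cf; apply: open_continuous_measurable_rV; first exact: openT.
by move=> x _; exact: cf.
Qed.

Lemma lebesgue_rV_compact K : compact K -> (lebesgue_rV N K < +oo)%E.
Proof.
move=> cK; have [M [_ HM]] := compact_bounded cK.
pose r := Num.max M 0 + 1.
have r0 : 0 <= r by rewrite addr_ge0 // le_max lexx orbT.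
pose B := [set y : 'rV[R]_N | forall i, `[- r, r]%classic (y ord0 i)].
have KB : K `<=` B.
  move=> y Ky i /=; rewrite in_itv /= -ler_norml.
  by have /ler_norm_rV -> // : `|y| <= r by apply: HM => //;
    rewrite ltr_pwDr // le_max lexx.
have cB : compact B.
  apply: (@rV_compact _ _ (fun=> `[- r, r]%classic)).
  by move=> i; exact: segment_compact.
apply: (@le_lt_trans _ _ (lebesgue_rV N B)).
  by apply: le_measure => //; rewrite inE; exact: measurable_compact_rV.
rewrite (@lebesgue_rV_box R N (fun=> `[- r, r]%classic)) //.
suff : (\prod_(i < N) lebesgue_measure `[(- r)%R, r]%classic)%E \is a fin_num.
  by rewrite fin_numElt => /andP[].
elim/big_ind: _ => [//|x y|i _]; first exact: fin_numM.
by rewrite lebesgue_measure_itv; case: ifP.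
Qed.

Lemma continuous_integrable (mu : {measure set 'rV[R]_N -> \bar R}) K f :
  compact K -> (mu K < +oo)%E -> continuous f -> (forall x, f x != 0 -> K x) ->
  mu.-integrable setT (EFin \o f).
Proof.
move=> cK muK cf fK; have mK := measurable_compact_rV cK.
have : mu.-integrable K (EFin \o f).
  apply: measurable_bounded_integrable => //.
    by apply: measurable_funS (continuous_measurable_rV cf).
  have [M M0 HM] := compact_bound cK (continuous_subspaceT cf).
  by exists M; split=> [|e Me x Kx];
    [exact: num_real|exact: le_trans (HM x Kx) (ltW Me)].
move=> /(integrable_mkcond _ mK); congr (_.-integrable _ _).
apply/funext => x; rewrite patchE; case: ifPn => //;
  rewrite notin_setE => Kx /=.
by congr EFin; apply/esym/eqP; apply: contrapT => /negP /fK.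
Qed.

End row_vectors.

(** Telescoping in each coordinate: the integer translates of the one-variable
    bump sum to 1, hence so do the products over a lattice of mesh [h]. *)
Lemma partition_of_unity (R : realType) (N : nat) (h B : R) : 0 < h ->
  exists (I : finType) (c : I -> 'rV[R]_N) (theta : I -> 'rV[R]_N -> R),
    [/\ forall i, smooth_on setT (theta i),
        forall i y, 0 <= theta i y,
        forall i y, theta i y != 0 -> `|y - c i| <= h &
        forall y, `|y| <= B -> \sum_i theta i y = 1].
Proof.
move=> h0; have [M BM] : exists M : nat, B / h <= M%:R.
  by exists (Num.truncn (B / h)).+1; rewrite ltW // truncnS_gt.
exists {ffun 'I_N -> 'I_(M.*2.+1)}.
pose c (k : {ffun 'I_N -> 'I_(M.*2.+1)}) : 'rV[R]_N :=
  \row_i (h * ((k i)%:R - M%:R)).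
exists c, (fun k => box_bump h (c k)); split.
- by move=> k; exact: smooth_box_bump.
- by move=> k y; exact: box_bump_ge0.
- by move=> k y; exact: box_bump_neq0.
- move=> y yB; rewrite /box_bump.
  have E i : \sum_(j < M.*2.+1) plateau (h^-1 * y ord0 i - (j%:R - M%:R)) = 1.
    apply: sum_plateau; rewrite normrM gtr0_norm ?invr_gt0 // mulrC
      ler_pdivrMr //.
    have B0 : 0 <= B by apply: le_trans yB.
    move: yB; rewrite ler_norm_rV // => /(_ i) /le_trans; apply.
    by rewrite -ler_pdivrMr.
  transitivity (\prod_(i < N) \sum_(j < M.*2.+1)
      plateau (h^-1 * y ord0 i - (j%:R - M%:R))); last by rewrite big1.
  rewrite bigA_distr_bigA /=; apply: eq_bigr => k _; apply: eq_bigr => i _.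
  by rewrite mxE mulrBr mulrA mulVf ?mul1r // gt_eqF.
Qed.

(** * Distributional inequalities in one variable *)

Section time_variable.
Context {R : realType}.
Notation lam := (@lebesgue_measure R).

Lemma continuous_integrable_real (f : R -> R) (a b : R) : continuous f ->
  (forall t, f t != 0 -> a <= t <= b) -> lam.-integrable setT (EFin \o f).
Proof.
move=> cf fab.
have : lam.-integrable `[a, b]%classic (EFin \o f).
  apply: continuous_compact_integrable; first exact: segment_compact.
  exact: continuous_subspaceT.
move=> /integrable_mkcond => /(_ (measurable_itv _)).
congr (_.-integrable _ _); apply/funext => x; rewrite patchE.
case: ifPn => //; rewrite notin_setE /= in_itv /= => abx.
by congr EFin; apply/esym/eqP; apply: contrapT => /negP /fab.
Qed.

(** A smooth approximation, rising on [[s, s + e]], of the indicator function of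
    the half-line that starts at [s]. *)
Definition ramp (s e t : R) : R := step (e^-1 * t + - (e^-1 * s)).

Lemma ramp_le0 s e t : 0 < e -> t <= s -> ramp s e t = 0.
Proof.
by move=> e0 ts; rewrite /ramp step_le0 // -mulrBr
  pmulr_rle0 ?invr_gt0 // subr_le0.
Qed.

Lemma ramp_ge1 s e t : 0 < e -> s + e <= t -> ramp s e t = 1.
Proof.
by move=> e0 ts; rewrite /ramp step_ge1 // -mulrBr ler_pdivlMl // mulr1; lra.
Qed.

Lemma smooth_ramp s e : smooth_on setT (ramp s e).
Proof. exact/smooth_rescale/smooth_step. Qed.

Lemma derive_ramp_ge0 s e t : 0 < e -> 0 <= 'D_1 (ramp s e) t.
Proof.
move=> e0; rewrite derive_rescale; last exact: smooth_step.
by rewrite mulr_ge0 ?invr_ge0 ?(ltW e0) // derive_step_ge0.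
Qed.

Lemma derive_ramp_neq0 s e t : 0 < e -> 'D_1 (ramp s e) t != 0 ->
  s <= t <= s + e.
Proof.
move=> e0; apply: contraR; rewrite negb_and -!ltNge => /orP[ts|ts]; apply/eqP.
  rewrite (@near_eq_derive R R R _ (cst (0 : R))) ?derive_cst //.
  near=> x; rewrite ramp_le0 //; apply: ltW; near: x; exact: lt_nbhsl.
rewrite (@near_eq_derive R R R _ (cst (1 : R))) ?derive_cst //.
near=> x; rewrite ramp_ge1 //; apply: ltW; near: x; exact: lt_nbhsr.
Unshelve. all: by end_near. Qed.

Lemma derive_ramp_integrable s e : 0 < e ->
  lam.-integrable setT (EFin \o 'D_1 (ramp s e)).
Proof.
move=> e0; apply: (@continuous_integrable_real _ s (s + e)) => [|t].
  exact/smooth_continuous/smooth_derive/smooth_ramp.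
exact: derive_ramp_neq0.
Qed.

Lemma integral_derive_ramp s e : 0 < e ->
  \int[lam]_t 'D_1 (ramp s e) t = 1.
Proof.
move=> e0; have sse : s < s + e by rewrite ltrDl.
have sr := smooth_ramp s e; have cr := smooth_continuous sr.
have D : (\int[lam]_(x in `[s, (s + e)%R]) ('D_1 (ramp s e) x)%:E =
    (ramp s e (s + e))%:E - (ramp s e s)%:E)%E.
  apply: (continuous_FTC2 sse).
  - apply: continuous_subspaceT.
    exact/smooth_continuous/smooth_derive/smooth_ramp.
  - split=> [t _||]; first exact: smooth_derivable.
      by apply: cvg_at_right_filter; exact: cr.
    by apply: cvg_at_left_filter; exact: cr.
  - by move=> t _; rewrite derive1E.
transitivity (fine (\int[lam]_(x in `[s, (s + e)%R]) ('D_1 (ramp s e) x)%:E)%E).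
  rewrite /Rintegral [in RHS]integral_mkcond; congr fine.
  apply: eq_integral => t _; rewrite patchE; case: ifPn => //.
  rewrite notin_setE /= in_itv /= => tse; congr EFin; apply/eqP.
  by apply: contrapT => /negP /(derive_ramp_neq0 e0).
by rewrite D ramp_ge1 // ramp_le0 // sube0.
Qed.

Lemma open_time (T : \bar R) : open [set t : R | 0 < t /\ (t%:E < T)%E].
Proof.
case: T => [T| |].
- rewrite (_ : mkset _ = `]0, T[%classic); first exact: interval_open.
  apply/seteqP; split=> t /=; rewrite in_itv /= lte_fin;
    first by move=> [-> ->].
  by move/andP.
- rewrite (_ : mkset _ = `]0, +oo[%classic); first exact: interval_open.
  by apply/seteqP; split=> t /=; rewrite in_itv /= andbT ltry; [case|].
- rewrite (_ : mkset _ = set0); first exact: open0.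
  by apply/seteqP; split=> t //= [_]; rewrite ltNge leNye.
Qed.

(** Testing with the difference of two steep ramps compares the averages of [W]
    just after [s] and just after [t]; by continuity these are close to [W s]
    and [W t]. *)
Lemma weak_derivative_le (T : \bar R) (W : R -> R) (C : R) : 0 <= C ->
  (forall t, 0 < t -> (t%:E < T)%E -> {for t, continuous W}) ->
  (forall (eta : R -> R) (a b : R), smooth_on setT eta ->
    (forall t, 0 <= eta t) -> 0 < a -> (b%:E < T)%E ->
    (forall t, eta t != 0 -> a <= t <= b) ->
    0 <= \int[lam]_t (W t * 'D_1 eta t + C * eta t)) ->
  forall s t, 0 < s -> s < t -> (t%:E < T)%E -> W t - W s <= C * (t - s).
Proof.
move=> C0 cW wW s t s0 st tT; rewrite leNgt; apply/negP => Wst.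
(* A quarter of the excess for each of the oscillation of [W] after [s], that
   after [t], and the error [C * e] due to the width of the ramps. *)
pose d := (W t - W s - C * (t - s)) / 4.
have d0 : 0 < d by rewrite divr_gt0 // subr_gt0.
have t0 := lt_trans s0 st.
have sT : (s%:E < T)%E by apply: lt_trans tT; rewrite lte_fin.
have near_s : \forall e \near (0 : R)^'+, forall x, s <= x <= s + e ->
  W x <= W s + d.
  have /cvgrPdist_le /(_ _ d0) := cW _ s0 sT; rewrite -nbhs_ballE.
  move=> [r /= r0 rW]; near=> e => x /andP[sx xe].
  have : ball s r x.
    rewrite /ball /= distrC ger0_norm ?subr_ge0 // ltrBlDl;
      apply: le_lt_trans xe _.
    by rewrite ltrD2l; near: e; exact: nbhs_right_lt.
  by move/rW => /=; rewrite ler_norml lerBlDr => /andP[+ _];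
    rewrite lerBrDr; lra.
have near_t : \forall e \near (0 : R)^'+, forall x, t <= x <= t + e ->
  W t - d <= W x.
  have /cvgrPdist_le /(_ _ d0) := cW _ t0 tT; rewrite -nbhs_ballE.
  move=> [r /= r0 rW]; near=> e => x /andP[sx xe].
  have : ball t r x.
    rewrite /ball /= distrC ger0_norm ?subr_ge0 // ltrBlDl;
      apply: le_lt_trans xe _.
    by rewrite ltrD2l; near: e; exact: nbhs_right_lt.
  by move/rW => /=; rewrite ler_norml; lra.
have near_T : \forall e \near (0 : R)^'+, ((t + e)%:E < T)%E.
  case: T tT {cW wW sT near_s near_t} => [T| |]; last by rewrite ltNge leNye.
    rewrite lte_fin => tT; near=> e; rewrite lte_fin -ltrBrDl.
    by near: e; apply: nbhs_right_lt; rewrite subr_gt0.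
  by move=> _; near=> e; exact: ltry.
have near_C : \forall e \near (0 : R)^'+, C * e <= d.
  near=> e; apply: (@le_trans _ _ ((C + 1) * e)).
    by rewrite ler_wpM2r // lerDl.
  rewrite mulrC -ler_pdivlMr; last by rewrite ltr_wpDl.
  by near: e; apply: nbhs_right_le; rewrite divr_gt0 // ltr_wpDl.
have [e [e0 [Ws [Wt [eT Ce]]]]] : exists e, 0 < e /\
    (forall x, s <= x <= s + e -> W x <= W s + d) /\
    (forall x, t <= x <= t + e -> W t - d <= W x) /\
    ((t + e)%:E < T)%E /\ C * e <= d.
  apply: (@filter_ex _ ((0 : R)^'+)); near=> e.
  by do !split; near: e => //; exact: nbhs_right_gt.
pose eta x := ramp s e x - ramp t e x.
have seta : smooth_on setT eta by apply: smoothB; exact: smooth_ramp.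
have eta01 x : 0 <= eta x <= 1.
  apply/andP; split; last first.
    by rewrite /eta lerBlDr; apply: le_trans (step_le1 _) _;
      rewrite lerDl step_ge0.
  rewrite subr_ge0 step_le // lerD2l lerN2 ler_pM2l ?invr_gt0 //; exact: ltW.
have eta_supp x : eta x != 0 -> s <= x <= t + e.
  apply: contraR; rewrite negb_and -!ltNge => /orP[/ltW xs|/ltW xs]; apply/eqP.
    by rewrite /eta !ramp_le0 ?subrr // (le_trans xs) // ltW.
  by rewrite /eta !ramp_ge1 ?subrr // (le_trans _ xs) // lerD2r ltW.
have Deta x : 'D_1 eta x = 'D_1 (ramp s e) x - 'D_1 (ramp t e) x.
  by rewrite [LHS]deriveB //; apply: smooth_derivable; exact: smooth_ramp.
have := wW eta s (t + e) seta (fun x => proj1 (andP (eta01 x))) s0 eT eta_supp.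
apply/negP; rewrite -ltNge.
pose G x := (W s + d) * 'D_1 (ramp s e) x + (- (W t - d)) * 'D_1 (ramp t e) x.
pose J := (\1_`[s, t + e]%classic : R -> R).
have iJ : lam.-integrable setT (EFin \o J).
  apply: integrable_indic_itv.
have iCJ : lam.-integrable setT (EFin \o (fun x => C * J x)).
  exact: (integrableZl measurableT C iJ).
have ir1 : lam.-integrable setT
    (EFin \o (fun x => (W s + d) * 'D_1 (ramp s e) x)).
  exact: (integrableZl measurableT (W s + d) (derive_ramp_integrable s e0)).
have ir2 : lam.-integrable setT
    (EFin \o (fun x => - (W t - d) * 'D_1 (ramp t e) x)).
  exact: (integrableZl measurableT (- (W t - d)) (derive_ramp_integrable t e0)).
have iG : lam.-integrable setT (EFin \o G).
  exact: (integrableD measurableT ir1 ir2).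
have Deta_supp x : 'D_1 eta x != 0 -> s <= x <= t + e.
  rewrite Deta => Dx; have [r0|/(derive_ramp_neq0 e0)/andP[sx xs]] := eqVneq
    ('D_1 (ramp s e) x) 0.
    move: Dx; rewrite r0 sub0r oppr_eq0 => /(derive_ramp_neq0 e0)/andP[tx ->].
    by rewrite (le_trans (ltW st)).
  by rewrite sx (le_trans xs) // lerD2r ltW.
apply: (@le_lt_trans _ _ (\int[lam]_x (G x + C * J x))).
  apply: le_Rintegral => //.
  - apply: (@continuous_integrable_real _ s (t + e)).
      move=> x; apply: (@continuousD _ _ _ (fun y => W y * 'D_1 eta y)
        (fun y => C * eta y)); last first.
        apply: (@continuousM _ _ (fun=> C) eta); first exact: cst_continuous.
        exact: smooth_continuous.
      have cD : continuous ('D_1 eta) by exact/smooth_continuous/smooth_derive.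
      apply: (@continuous_mul_support _ _
        [set x | 0 < x /\ (x%:E < T)%E]) => //.
      + exact: open_time.
      + by move=> y [y0 yT]; exact: cW.
      + apply: subset_trans (compact_support_sub
        (@segment_compact _ s (t + e)) _) _.
          by move=> y /Deta_supp; rewrite /= in_itv.
        move=> y /=; rewrite in_itv /= => /andP[sy yt].
        split; first exact: lt_le_trans sy.
        by apply: le_lt_trans eT; rewrite lee_fin.
    move=> x; have [->|/eta_supp//] := eqVneq (eta x) 0.
    have [->|/Deta_supp//] := eqVneq ('D_1 eta x) 0.
    by rewrite !mulr0 addr0 eqxx.
  - exact: (integrableD measurableT iG iCJ).
  - move=> x _; apply: lerD.
      rewrite Deta /G mulrBr mulNr lerB //.
        have [->|/(derive_ramp_neq0 e0)/Ws Wx] := eqVneq ('D_1 (ramp s e) x) 0.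
          by rewrite !mulr0.
        by rewrite ler_wpM2r ?derive_ramp_ge0.
      have [->|/(derive_ramp_neq0 e0)/Wt Wx] := eqVneq ('D_1 (ramp t e) x) 0.
        by rewrite !mulr0.
      by rewrite ler_wpM2r ?derive_ramp_ge0.
    rewrite ler_wpM2l // /J indicE; have [->|/eta_supp xs] := eqVneq (eta x) 0.
      by rewrite ler0n.
    by rewrite mem_set /= ?in_itv // ; have /andP[] := eta01 x.
rewrite (RintegralD measurableT iG iCJ) (RintegralD measurableT ir1 ir2).
rewrite (RintegralZl _ measurableT (derive_ramp_integrable s e0)).
rewrite (RintegralZl _ measurableT (derive_ramp_integrable t e0)).
rewrite (RintegralZl _ measurableT iJ).
rewrite !integral_derive_ramp // !mulr1.
have -> : \int[lam]_x J x = t + e - s.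
  rewrite /Rintegral /J integral_indic // setIT.
  have L : lebesgue_measure `[s, t + e]%classic = (t + e - s)%:E.
    rewrite lebesgue_measure_itv /= lte_fin ifT //.
    by apply: lt_trans st _; rewrite ltrDl.
  by rewrite -[RHS]/(fine (t + e - s)%:E); congr fine; exact: L.
have dE : W t - W s - C * (t - s) = 4 * d by rewrite /d; field.
by lra.
Unshelve. all: by end_near. Qed.

End time_variable.

(** * Weighted masses of a space-time function *)

Lemma ex_time_gt (R : realType) (T : \bar R) (t : R) : (t%:E < T)%E ->
  exists2 t1, t < t1 & (t1%:E < T)%E.
Proof.
case: T => [r| |]; last by rewrite ltNge leNye.
  by rewrite lte_fin => tr; exists ((t + r) / 2); rewrite ?lte_fin; lra.
by move=> _; exists (t + 1); rewrite ?ltry // ltrDl.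
Qed.

Lemma integrable_indic_lty d (X : measurableType d) (R : realType)
    (mu : {measure set X -> \bar R}) (A : set X) :
  measurable A -> (mu A < +oo)%E -> mu.-integrable setT (EFin \o \1_A).
Proof.
move=> mA muA; apply/integrableP; split.
  by apply/measurable_EFinP; exact: measurable_indic.
rewrite (eq_integral (fun x => (\1_A x)%:E)).
  by rewrite integral_indic // setIT.
by move=> x _ /=; rewrite ger0_norm.
Qed.

Section space_time.
Context {R : realType} {N : nat}.
Implicit Types (Omega K : set 'rV[R]_N) (T : \bar R) (w : 'rV[R]_N * R -> R).

Lemma continuous_slice_space Omega T w t : 0 < t -> (t%:E < T)%E ->
  (forall z, cylinder Omega T z -> {for z, continuous w}) ->
  forall x, Omega x -> {for x, continuous (fun y => w (y, t))}.
Proof.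
move=> t0 tT cw x Ox; have cz := cw (x, t) (conj Ox (conj t0 tT)).
apply: (@continuous_comp _ _ _ (fun y => (y, t)) w) => //.
have c1 : (y, t) @[y --> x] --> (x, t).
  exact: (@cvg_pair _ _ _ (nbhs x) (nbhs x) (nbhs t) _ _ _ id (fun=> t)
    cvg_id (cvg_cst _)).
exact: c1.
Qed.

Lemma continuous_slice_time Omega T w t x : 0 < t -> (t%:E < T)%E -> Omega x ->
  (forall z, cylinder Omega T z -> {for z, continuous w}) ->
  {for t, continuous (fun s => w (x, s))}.
Proof.
move=> t0 tT Ox cw; have cz := cw (x, t) (conj Ox (conj t0 tT)).
apply: (@continuous_comp _ _ _ (fun s : R => (x, s)) w) => //.
have c1 : (x, s) @[s --> t] --> (x, t).
  exact: (@cvg_pair _ _ _ (nbhs t) (nbhs x) (nbhs t) _ _ _ (fun=> x) id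
    (cvg_cst _) cvg_id).
exact: c1.
Qed.

Definition mass w (phi : 'rV[R]_N -> R) (t : R) : R :=
  \int[lebesgue_rV N]_x (w (x, t) * phi x).

Section mass.
Variables (Omega : set 'rV[R]_N) (T : \bar R) (w : 'rV[R]_N * R -> R).
Hypothesis oO : open Omega.
Hypothesis cw : forall z, cylinder Omega T z -> {for z, continuous w}.

Lemma continuous_mass_integrand phi t : Cc0 Omega phi -> 0 < t ->
  (t%:E < T)%E -> continuous (fun x => w (x, t) * phi x).
Proof.
move=> [cphi [_ sphi]] t0 tT; apply: (continuous_mul_support oO) => // x Ox.
exact: continuous_slice_space cw _ Ox.
Qed.

Lemma mass_integrable phi t : Cc0 Omega phi -> 0 < t -> (t%:E < T)%E ->
  (lebesgue_rV N).-integrable setT (EFin \o (fun x => w (x, t) * phi x)).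
Proof.
move=> cp t0 tT; have [cphi [kphi sphi]] := cp.
apply: (continuous_integrable kphi (lebesgue_rV_compact kphi)).
  exact: continuous_mass_integrand.
by move=> x wx; apply: subset_closure => /=; apply: contra_neq wx => ->;
  rewrite mulr0.
Qed.

Lemma massD phi psi t : Cc0 Omega phi -> Cc0 Omega psi -> 0 < t ->
  (t%:E < T)%E ->
  mass w (fun x => phi x + psi x) t = mass w phi t + mass w psi t.
Proof.
move=> cp cs t0 tT; rewrite -RintegralD //; [|exact: mass_integrable..].
by apply: eq_Rintegral => x _; rewrite mulrDr.
Qed.

Lemma massZ a phi t : Cc0 Omega phi -> 0 < t -> (t%:E < T)%E ->
  mass w (fun x => a * phi x) t = a * mass w phi t.
Proof.
move=> cp t0 tT; rewrite -RintegralZl //; last exact: mass_integrable.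
by apply: eq_Rintegral => x _; rewrite mulrCA.
Qed.

Lemma le_mass phi psi t : (forall z, cylinder Omega T z -> 0 <= w z) ->
  Cc0 Omega phi -> Cc0 Omega psi -> 0 < t -> (t%:E < T)%E ->
  (forall x, phi x <= psi x) -> mass w phi t <= mass w psi t.
Proof.
move=> w0 cp cs t0 tT ps; apply: le_Rintegral => //.
- exact: mass_integrable.
- exact: mass_integrable.
- move=> x _; have [Ox|Ox] := pselect (Omega x).
    by rewrite ler_wpM2l // w0.
  have z f : Cc0 Omega f -> f x = 0.
    by move=> [_ [_ sf]]; apply: contrapT => /eqP fx;
      apply/Ox/sf/subset_closure.
  by rewrite !z // !mulr0.
Qed.

Lemma continuous_mass phi t : Cc0 Omega phi -> 0 < t -> (t%:E < T)%E ->
  {for t, continuous (mass w phi)}.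
Proof.
move=> cp t0 tT; have [cphi [kphi sphi]] := cp.
set K := closure _ in kphi sphi.
have [t1 tt1 t1T] : exists2 t1, t < t1 & (t1%:E < T)%E.
  exact: ex_time_gt.
have t20 : 0 < t / 2 by rewrite divr_gt0.
have sub z : (K `*` `[t / 2, t1]%classic) z -> cylinder Omega T z.
  move=> [/= /sphi Oz]; rewrite in_itv /= => /andP[z1 z2]; split => //; split.
    exact: lt_le_trans z1.
  by apply: le_lt_trans t1T; rewrite lee_fin.
have [M M0 HM] : exists2 M, 0 < M &
    forall z, (K `*` `[t / 2, t1]%classic) z -> `|w z * phi z.1| <= M.
  apply: compact_bound.
    by apply: compact_setX => //; exact: segment_compact.
  apply: continuous_in_subspaceT => z /set_mem /sub Qz.
  apply: (@continuousM _ _ w (fun z => phi z.1)); first exact: cw.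
  apply: (@continuous_comp _ _ _ fst phi); first exact: cvg_fst.
  exact: cphi.
have mK := measurable_compact_rV kphi.
apply: (@continuity_under_integral R _ _ (lebesgue_rV N)
    (fun s x => w (x, s) * phi x) setT measurableT (t / 2) t1 _ _
    (fun x => M * \1_K x)).
- move=> s /=; rewrite in_itv /= => /andP[s1 s2]; apply: mass_integrable => //.
    exact: lt_trans s1.
  by apply: lt_trans t1T; rewrite lte_fin.
- apply: aeW => x _ s /set_mem /=; rewrite in_itv /= => /andP[s1 s2].
  have [Ox|Ox] := pselect (Omega x); last first.
    have -> : phi x = 0.
      by apply: contrapT => /eqP fx; apply/Ox/sphi/subset_closure.
    by under eq_fun do rewrite mulr0; exact: cst_continuous.
  apply: (@continuousM _ _ (fun s => w (x, s)) (fun=> phi x));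
    last exact: cst_continuous.
  apply: continuous_slice_time cw => //; first exact: lt_trans s1.
  by apply: lt_trans t1T; rewrite lte_fin.
- rewrite (_ : _ \o _ = fun x => (M%:E * (\1_K x)%:E)%E) //.
  apply: integrableZl => //; apply: integrable_indic_lty => //;
    exact: lebesgue_rV_compact.
- move=> s /=; rewrite in_itv /= => /andP[s1 s2]; apply: aeW => x _.
  rewrite indicE; have [xK|xK] := boolP (x \in K).
    rewrite mulr1; apply: (HM (x, s)); split => /=; first exact: set_mem.
    by rewrite in_itv /= !ltW.
  have -> : phi x = 0; last by rewrite mulr0 normr0 mulr0.
  by apply: contrapT => /eqP fx; move/negP: xK; apply;
    apply/mem_set/subset_closure.
- by rewrite inE /= in_itv /= tt1 andbT ltr_pdivrMr // ltr_pMr // ltr1n.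
Qed.

End mass.
End space_time.

(** * Test functions and their tensor products *)

Section test_functions.
Context {R : realType}.

Lemma derive_support (V : normedModType R) (f : V -> R) v :
  closure [set x | 'D_v f x != 0] `<=` closure [set x | f x != 0].
Proof.
rewrite closureE; apply: smallest_sub; first exact: closed_closure.
move=> x /=; apply: contraPP => /= fx; apply/negP; rewrite negbK; apply/eqP.
rewrite (@near_eq_derive R V R f (cst 0)) ?derive_cst //.
have : nbhs x (~` closure [set x | f x != 0]).
  by apply: open_nbhs_nbhs; split => //; exact/closed_openC/closed_closure.
apply: filterS => y fy; apply: contrapT => /eqP f0.
by apply: fy; exact: subset_closure.
Qed.

Lemma test_function_Cc0 (V : normedModType R) (W : set V) f :
  test_function W f -> Cc0 W f.
Proof. by move=> [sf cf]; split => //; exact: smooth_continuous. Qed.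

Lemma test_function_derive (V : normedModType R) (W : set V) f v :
  test_function W f -> test_function W ('D_v f).
Proof.
move=> [sf [kf cf]]; split; first exact: smooth_derive.
split; last by apply: subset_trans cf; exact: derive_support.
by apply: subclosed_compact kf (@derive_support _ _ _); exact: closed_closure.
Qed.

Lemma compact_support_hull (V : normedModType R) (W : set V) (f g : V -> R) :
  compact_support_in W g -> (forall x, g x = 0 -> f x = 0) ->
  compact_support_in W f.
Proof.
move=> [kg gW] gf; apply: (compact_support_inW kg gW) => x fx.
by apply: subset_closure => /=; apply: contra_neq fx; exact: gf.
Qed.

Lemma compact_support_inD (V : normedModType R) (W : set V) (f g : V -> R) :
  compact_support_in W f -> compact_support_in W g ->
  compact_support_in W (fun x => f x + g x).
Proof.
move=> [kf fW] [kg gW]; apply: (compact_support_inW (compactU kf kg)).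
  by move=> x [/fW|/gW].
move=> x fg; have [fx|fx] := eqVneq (f x) 0; last by left;
  exact: subset_closure.
by right; apply: subset_closure => /=; move: fg; rewrite fx add0r.
Qed.

Lemma Cc0D (V : normedModType R) (W : set V) (f g : V -> R) :
  Cc0 W f -> Cc0 W g -> Cc0 W (fun x => f x + g x).
Proof.
move=> [cf kf] [cg kg]; split; last exact: compact_support_inD.
by move=> x; apply: continuousD; [exact: cf|exact: cg].
Qed.

Lemma Cc0Ml (V : normedModType R) (W : set V) (f g : V -> R) :
  continuous f -> Cc0 W g -> Cc0 W (fun x => f x * g x).
Proof.
move=> cf [cg kg]; split.
  by move=> x; apply: continuousM; [exact: cf|exact: cg].
by apply: compact_support_hull kg _ => x ->; rewrite mulr0.
Qed.

Lemma Cc0Z (V : normedModType R) (W : set V) a (f : V -> R) :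
  Cc0 W f -> Cc0 W (fun x => a * f x).
Proof. by apply: Cc0Ml => x; exact: cst_continuous. Qed.

Lemma Cc0_cst0 (V : normedModType R) (W : set V) : Cc0 W (fun=> 0 : R).
Proof.
split; first by move=> x; exact: cst_continuous.
by apply: (compact_support_inW (@compact0 _)) => // x; rewrite eqxx.
Qed.

Lemma Cc0_sum (V : normedModType R) (W : set V) (I : Type) (s : seq I)
    (F : I -> V -> R) : (forall i, Cc0 W (F i)) ->
  Cc0 W (fun x => \sum_(i <- s) F i x).
Proof.
move=> cF; elim: s => [|i s IH].
  rewrite [X in Cc0 _ X](_ : _ = fun=> 0); first exact: Cc0_cst0.
  by apply/funext => x; rewrite big_nil.
rewrite [X in Cc0 _ X](_ : _ = fun x => F i x + \sum_(j <- s) F j x).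
  exact: Cc0D.
by apply/funext => x; rewrite big_cons.
Qed.

Lemma test_functionD (V : normedModType R) (W : set V) (f g : V -> R) :
  test_function W f -> test_function W g ->
    test_function W (fun x => f x + g x).
Proof.
move=> [sf kf] [sg kg]; split; [exact: smoothD|exact: compact_support_inD].
Qed.

Lemma test_functionZ (V : normedModType R) (W : set V) a (f : V -> R) :
  test_function W f -> test_function W (fun x => a * f x).
Proof.
move=> [sf kf]; split; first exact: smoothZ.
by apply: compact_support_hull kf _ => x ->; rewrite mulr0.
Qed.

Lemma derive_support_itv (f : R -> R) a b :
  (forall t, f t != 0 -> a <= t <= b) ->
  forall t, 'D_1 f t != 0 -> a <= t <= b.
Proof.
move=> fab t Dt; have : `[a, b]%classic t; last by rewrite /= in_itv.
apply: (@compact_support_sub _ _ _ f); first exact: segment_compact.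
  by move=> x /fab; rewrite /= in_itv.
by apply: (@derive_support _ f 1);
  exact: (@subset_closure _ [set x | 'D_1 f x != 0] t Dt).
Qed.

End test_functions.

Definition space_laplacian {R : realType} {N : nat} (phi : 'rV[R]_N -> R)
  x : R :=
  \sum_(i < N) 'D_(delta_mx 0 i) ('D_(delta_mx 0 i) phi) x.

Section tensor.
Context {R : realType} {N : nat}.
Implicit Types (phi : 'rV[R]_N -> R) (eta : R -> R) (z : 'rV[R]_N * R).

Let linear_fst : linear (@fst 'rV[R]_N R). Proof. by []. Qed.
Let linear_snd : linear (@snd 'rV[R]_N R). Proof. by []. Qed.
Let continuous_fst : continuous (@fst 'rV[R]_N R).
Proof. by move=> z; exact: cvg_fst. Qed.
Let continuous_snd : continuous (@snd 'rV[R]_N R).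
Proof. by move=> z; exact: cvg_snd. Qed.

Let fstE phi : (fun z : 'rV[R]_N * R => phi z.1) = fun z => phi (z.1 + 0).
Proof. by apply/funext => z; rewrite addr0. Qed.
Let sndE eta : (fun z : 'rV[R]_N * R => eta z.2) = fun z => eta (z.2 + 0).
Proof. by apply/funext => z; rewrite addr0. Qed.

Lemma smooth_fst phi : smooth_on setT phi ->
  smooth_on setT (fun z : 'rV[R]_N * R => phi z.1).
Proof.
by move=> sp; rewrite fstE;
  exact: (smooth_affine 0 linear_fst continuous_fst sp).
Qed.

Lemma smooth_snd eta : smooth_on setT eta ->
  smooth_on setT (fun z : 'rV[R]_N * R => eta z.2).
Proof.
by move=> se; rewrite sndE;
  exact: (smooth_affine 0 linear_snd continuous_snd se).
Qed.

Let derive_fst phi (a : 'rV[R]_N) (c : R) z : smooth_on setT phi ->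
  'D_(a, c) (fun z : 'rV[R]_N * R => phi z.1) z = 'D_a phi z.1.
Proof.
move=> sp; rewrite fstE.
rewrite (@derive_affine _ _ _ _ 0 linear_fst continuous_fst phi z (a, c)).
  by rewrite addr0.
exact: smooth_differentiable.
Qed.

Let derive_snd eta (a : 'rV[R]_N) (c : R) z : smooth_on setT eta ->
  'D_(a, c) (fun z : 'rV[R]_N * R => eta z.2) z = 'D_c eta z.2.
Proof.
move=> se; rewrite sndE.
rewrite (@derive_affine _ _ _ _ 0 linear_snd continuous_snd eta z (a, c)).
  by rewrite addr0.
exact: smooth_differentiable.
Qed.

Lemma derive_tensor phi eta (a : 'rV[R]_N) (c : R) z :
  smooth_on setT phi -> smooth_on setT eta ->
  'D_(a, c) (fun z => phi z.1 * eta z.2) z =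
  phi z.1 * 'D_c eta z.2 + 'D_a phi z.1 * eta z.2.
Proof.
move=> sp se; rewrite [LHS]deriveM; last 2 first.
- exact: smooth_derivable (smooth_fst sp).
- exact: smooth_derivable (smooth_snd se).
by rewrite derive_fst // derive_snd // /GRing.scale /= [X in _ + X]mulrC.
Qed.

Lemma dt_tensor phi eta z : smooth_on setT phi -> smooth_on setT eta ->
  dt (fun z => phi z.1 * eta z.2) z = phi z.1 * 'D_1 eta z.2.
Proof.
move=> sp se; rewrite /dt derive_tensor //.
by rewrite (_ : 'D_0 phi z.1 = 0) ?mul0r ?addr0 // derive0.
Qed.

Lemma dx_tensor i phi eta : smooth_on setT phi -> smooth_on setT eta ->
  dx i (fun z => phi z.1 * eta z.2) =
  fun z => 'D_(delta_mx 0 i) phi z.1 * eta z.2.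
Proof.
move=> sp se; apply/funext => z; rewrite /dx derive_tensor //.
by rewrite (_ : 'D_0 eta z.2 = 0) ?mulr0 ?add0r // derive0.
Qed.

Lemma laplacian_tensor phi eta z : smooth_on setT phi -> smooth_on setT eta ->
  laplacian (fun z => phi z.1 * eta z.2) z = space_laplacian phi z.1 * eta z.2.
Proof.
move=> sp se; rewrite /laplacian /space_laplacian mulr_suml.
apply: eq_bigr => i _; rewrite dx_tensor //
  (dx_tensor i (smooth_derive _ sp) se).
by [].
Qed.

Lemma test_function_tensor (Omega : set 'rV[R]_N) (T : \bar R) phi eta
  (a b : R) :
  test_function Omega phi -> smooth_on setT eta -> 0 < a -> (b%:E < T)%E ->
  (forall t, eta t != 0 -> a <= t <= b) ->
  test_function (cylinder Omega T) (fun z => phi z.1 * eta z.2).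
Proof.
move=> [sp [kp pO]] se a0 bT eab; split.
  by apply: smoothM; [exact: smooth_fst|exact: smooth_snd].
apply: (compact_support_inW (compact_setX kp (@segment_compact _ a b))).
  move=> z [/pO Oz] /=; rewrite in_itv /= => /andP[az zb]; split => //; split.
    exact: lt_le_trans az.
  by apply: le_lt_trans bT; rewrite lee_fin.
move=> z /=; rewrite mulf_eq0 negb_or => /andP[pz ez]; split.
  exact: subset_closure.
by rewrite /= in_itv /= eab.
Qed.

Lemma space_laplacian_Cc0 (Omega : set 'rV[R]_N) phi : test_function
  Omega phi ->
  Cc0 Omega (space_laplacian phi).
Proof.
move=> tp; apply: Cc0_sum => i; apply: test_function_Cc0.
exact/test_function_derive/test_function_derive.
Qed.

End tensor.

(** * The weak formulation as a growth bound for weighted masses *)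

Section weak_formulation.
Context {R : realType} {N : nat}.
Variables (Omega : set 'rV[R]_N) (T : \bar R).
Hypothesis oO : open Omega.
Let Q := cylinder Omega T.
Local Notation ST := ('rV[R]_N * measurableTypeR R)%type.

Lemma measurable_cylinder : measurable (Q : set ST).
Proof.
rewrite (_ : Q = Omega `*` [set t : R | 0 < t /\ (t%:E < T)%E]).
  apply: measurableX; first exact: open_measurable_rV.
  by apply: open_measurable; exact: open_time.
by apply/seteqP; split=> -[x t] /= [].
Qed.

Lemma space_time_integrable (w : 'rV[R]_N * R -> R) phi eta (a b : R) :
  measurable_fun (Q : set ST) w -> (forall z, Q z -> {for z, continuous w}) ->
  Cc0 Omega phi -> continuous eta -> 0 < a -> (b%:E < T)%E ->
  (forall t, eta t != 0 -> a <= t <= b) ->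
  spacetime_measure.-integrable setT
    (EFin \o (fun z : ST => w z * (phi z.1 * eta z.2))).
Proof.
move=> mw cw [cphi [kphi sphi]] ceta a0 bT eab.
set K := closure _ in kphi sphi.
pose KI := K `*` `[a, b]%classic.
have sub z : KI z -> Q z.
  move=> [/= /sphi Oz]; rewrite in_itv /= => /andP[z1 z2]; split => //; split.
    exact: lt_le_trans z1.
  by apply: le_lt_trans bT; rewrite lee_fin.
have kKI : compact KI by apply: compact_setX => //; exact: segment_compact.
have out z : ~ KI z -> w z * (phi z.1 * eta z.2) = 0.
  move=> nz; apply: contrapT => /eqP; rewrite !mulf_eq0 !negb_or.
  move=> /andP[_ /andP[pz ez]]; apply: nz; split; first exact: subset_closure.
  by rewrite /= in_itv /= eab.
have [M M0 HM] : exists2 M, 0 < M &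
    forall z, KI z -> `|w z * (phi z.1 * eta z.2)| <= M.
  apply: compact_bound => //.
  apply: continuous_in_subspaceT => z /set_mem /sub Qz.
  apply: (@continuousM _ _ w (fun z => phi z.1 * eta z.2)); first exact: cw.
  apply: (@continuousM _ _ (fun z => phi z.1) (fun z => eta z.2)).
    by apply: (@continuous_comp _ _ _ fst phi); [exact: cvg_fst|exact: cphi].
  by apply: (@continuous_comp _ _ _ snd eta); [exact: cvg_snd|exact: ceta].
have mKI : measurable (KI : set ST).
  by apply: measurableX => //; exact: measurable_compact_rV.
have fKI : (spacetime_measure KI < +oo)%E.
  rewrite /spacetime_measure product_measure1E //;
    last exact: measurable_compact_rV.
  apply: lte_mul_pinfty => //.
    by rewrite ge0_fin_numE // lebesgue_rV_compact.
  have := @compact_finite_measure R _ (@segment_compact R a b). exact.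
apply: (@le_integrable _ _ _ spacetime_measure setT measurableT _
    (fun z => (M * \1_KI z)%:E)).
- apply/measurable_EFinP.
  rewrite [X in measurable_fun _ X](_ : _
    = (fun z : ST => w z * (phi z.1 * eta z.2)) \_ (Q : set ST)).
    apply/(measurable_restrictT _ measurable_cylinder).
    apply: measurable_funM => //; apply: measurable_funTS.
    apply: measurable_funM.
      exact: measurableT_comp (continuous_measurable_rV cphi) measurable_fst.
    exact: measurableT_comp (continuous_measurable_fun ceta) measurable_snd.
  apply/funext => z; rewrite patchE; case: ifPn => // /negP nz.
  by apply: out => /sub Qz; apply: nz; exact: mem_set.
- move=> z _ /=; rewrite lee_fin [leRHS]ger0_norm; last first.
    by rewrite mulr_ge0 ?(ltW M0).
  rewrite indicE; have [zK|zK] := boolP (z \in KI).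
    by rewrite mulr1; apply: HM; exact: set_mem.
  by rewrite out ?normr0 ?mulr0 // => zk; move/negP: zK; apply; exact: mem_set.
- rewrite (_ : (fun z => _) = fun z => (M%:E * (\1_KI z)%:E)%E) //.
  by apply: integrableZl => //; exact: integrable_indic_lty.
Qed.

Lemma integral_cylinder (F : ST -> R) : (forall z, ~ Q z -> F z = 0) ->
  (\int[spacetime_measure]_(z in Q) (F z)%:E =
   \int[spacetime_measure]_z (F z)%:E)%E.
Proof.
move=> FQ; rewrite integral_mkcond; apply: eq_integral => z _.
by rewrite patchE; case: ifPn => // /negP nz; rewrite FQ // => /mem_set.
Qed.

Variables (p q : R) (u v : 'rV[R]_N * R -> R).
Hypothesis huv : positive_solution p q Q u v.
Hypotheses (hu : smooth_on Q u) (hv : smooth_on Q v).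

Let cu z : Q z -> {for z, continuous u}. Proof. exact: (hu 0). Qed.
Let cv z : Q z -> {for z, continuous v}. Proof. exact: (hv 0). Qed.
Let u_gt0 z : Q z -> 0 < u z. Proof. by case: huv => + _ _ _ _; apply. Qed.
Let v_gt0 z : Q z -> 0 < v z. Proof. by case: huv => _ + _ _ _; apply. Qed.
Let mu : measurable_fun (Q : set ST) u. Proof. by case: huv => _ _ []. Qed.
Let mv : measurable_fun (Q : set ST) v. Proof. by case: huv => _ _ _ []. Qed.

Lemma continuous_powR_comp (w : 'rV[R]_N * R -> R) r z : 0 < w z ->
  {for z, continuous w} -> {for z, continuous (fun x => w x `^ r)}.
Proof.
move=> w0 cw; apply: (@continuous_comp _ _ _ w (fun x => x `^ r)) => //.
have [d _] := is_derive1_powR r w0.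
by apply/differentiable_continuous; exact/derivable1_diffP.
Qed.

Let tensor_algebra (x l1 y f1 x' l2 y' f2 e : R) :
  x * (l1 * e) - y * (f1 * e) + (x' * (l2 * e) - y' * (f2 * e)) =
  (x * l1 - y * f1 + (x' * l2 - y' * f2)) * e.
Proof. by ring. Qed.

Let sum_ge0 (a1 b1 d1 a2 b2 d2 x : R) : d1 - (a1 + b1) = 0 ->
  d2 - (a2 + b2) = 0 -> b1 - d1 + (b2 - d2) <= x -> 0 <= a1 + a2 + x.
Proof. by lra. Qed.

Let slice_algebra (d x f1 y f2 e c : R) :
  d * (x * f1) + d * (y * f2) + e * c =
  x * (f1 * d) + y * (f2 * d) + 1 * (c * e).
Proof. by ring. Qed.

Section tested.
Variables (phi1 phi2 chi : 'rV[R]_N -> R).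
Hypotheses (t1 : test_function Omega phi1) (t2 : test_function Omega phi2).
Hypotheses (cchi : Cc0 Omega chi).
Hypothesis bound : forall z, Q z ->
  u z * space_laplacian phi1 z.1 - v z `^ p * phi1 z.1 +
  (v z * space_laplacian phi2 z.1 - u z `^ q * phi2 z.1) <= chi z.1.

Let W t := mass u phi1 t + mass v phi2 t.
Let C := \int[lebesgue_rV N]_x chi x.

(** The two weak equations are added, and Fubini's theorem moves the space
    integrals inside; the Laplacian falls on the space factors and the time
    derivative on [eta], which alone is left to be integrated. *)
Lemma tested_weak_inequality eta (a b : R) : smooth_on setT eta ->
  (forall t, 0 <= eta t) -> 0 < a -> (b%:E < T)%E ->
  (forall t, eta t != 0 -> a <= t <= b) ->
  0 <= \int[lebesgue_measure]_t (W t * 'D_1 eta t + C * eta t).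
Proof.
move=> se eta0 a0 bT eab.
have ceta := smooth_continuous se.
have cDeta : continuous ('D_1 eta) by exact/smooth_continuous/smooth_derive.
have Dab := derive_support_itv eab.
have [[c1 _] [c2 _]] := (test_function_Cc0 t1, test_function_Cc0 t2).
have I (w : 'rV[R]_N * R -> R) (phi : 'rV[R]_N -> R) (f : R -> R) :
  measurable_fun (Q : set ST) w ->
    (forall z, Q z -> {for z, continuous w}) -> Cc0 Omega phi ->
    continuous f -> (forall t, f t != 0 -> a <= t <= b) ->
    spacetime_measure.-integrable setT
      (EFin \o (fun z : ST => w z * (phi z.1 * f z.2))).
  move=> mw cw cphi cf fab.
  exact: (space_time_integrable mw cw cphi cf a0 bT fab).
have mup : measurable_fun (Q : set ST) (fun z => u z `^ q).
  exact: (measurableT_comp (measurable_powR q) mu).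
have mvp : measurable_fun (Q : set ST) (fun z => v z `^ p).
  exact: (measurableT_comp (measurable_powR p) mv).
have cup z : Q z -> {for z, continuous (fun z => u z `^ q)}.
  by move=> Qz; apply: continuous_powR_comp; [exact: u_gt0|exact: cu].
have cvp z : Q z -> {for z, continuous (fun z => v z `^ p)}.
  by move=> Qz; apply: continuous_powR_comp; [exact: v_gt0|exact: cv].
have tt1 := test_function_tensor t1 se a0 bT eab.
have tt2 := test_function_tensor t2 se a0 bT eab.
pose A1 (z : ST) := u z * (phi1 z.1 * 'D_1 eta z.2).
pose B1 (z : ST) := u z * (space_laplacian phi1 z.1 * eta z.2).
pose D1 (z : ST) := v z `^ p * (phi1 z.1 * eta z.2).
pose A2 (z : ST) := v z * (phi2 z.1 * 'D_1 eta z.2).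
pose B2 (z : ST) := v z * (space_laplacian phi2 z.1 * eta z.2).
pose D2 (z : ST) := u z `^ q * (phi2 z.1 * eta z.2).
pose X (z : ST) := 1 * (chi z.1 * eta z.2).
have [T1 T2] := (test_function_Cc0 t1, test_function_Cc0 t2).
have [L1 L2] := (space_laplacian_Cc0 t1, space_laplacian_Cc0 t2).
have iA1 : spacetime_measure.-integrable setT (EFin \o A1).
  exact: (I _ _ _ mu cu T1 cDeta Dab).
have iB1 : spacetime_measure.-integrable setT (EFin \o B1).
  exact: (I _ _ _ mu cu L1 ceta eab).
have iD1 : spacetime_measure.-integrable setT (EFin \o D1).
  exact: (I _ _ _ mvp cvp T1 ceta eab).
have iA2 : spacetime_measure.-integrable setT (EFin \o A2).
  exact: (I _ _ _ mv cv T2 cDeta Dab).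
have iB2 : spacetime_measure.-integrable setT (EFin \o B2).
  exact: (I _ _ _ mv cv L2 ceta eab).
have iD2 : spacetime_measure.-integrable setT (EFin \o D2).
  exact: (I _ _ _ mup cup T2 ceta eab).
have iX : spacetime_measure.-integrable setT (EFin \o X).
  apply: (I (fun=> 1) chi eta) => //.
  move=> z _; exact: cst_continuous.
have iD (f g : ST -> R) : spacetime_measure.-integrable setT (EFin \o f) ->
    spacetime_measure.-integrable setT (EFin \o g) ->
    spacetime_measure.-integrable setT (EFin \o (fun z => f z + g z)).
  move=> f_int g_int.
  rewrite (_ : _ \o _ = fun z => ((f z)%:E + (g z)%:E)%E) //;
    exact: integrableD.
have iB (f g : ST -> R) : spacetime_measure.-integrable setT (EFin \o f) ->
    spacetime_measure.-integrable setT (EFin \o g) ->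
    spacetime_measure.-integrable setT (EFin \o (fun z => f z - g z)).
  move=> f_int g_int.
  rewrite (_ : _ \o _ = fun z => ((f z)%:E - (g z)%:E)%E) //;
    exact: integrableB.
have out z : ~ Q z -> eta z.2 = 0 /\ 'D_1 eta z.2 = 0 \/
    [/\ phi1 z.1 = 0, phi2 z.1 = 0, space_laplacian phi1 z.1 = 0,
        space_laplacian phi2 z.1 = 0 & chi z.1 = 0].
  move=> nQ; have [zab|zab] := boolP (a <= z.2 <= b); [right|left]; last first.
    by split; apply: contrapT => /eqP; [move/eab|move/Dab]; apply/negP.
  have nO : ~ Omega z.1.
    move=> Oz; apply: nQ; move/andP: zab => [az zb]; split => //; split.
      exact: lt_le_trans az.
    by apply: le_lt_trans bT; rewrite lee_fin.
  have z0 f : Cc0 Omega f -> f z.1 = 0.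
    by move=> [_ [_ sf]]; apply: contrapT => /eqP fx;
      apply/nO/sf/subset_closure.
  by split; apply: z0; by [|exact: test_function_Cc0|exact:
    space_laplacian_Cc0].
have [_ _ _ _ weak] := huv.
have [E1 _] := weak _ tt1; have [_ E2] := weak _ tt2.
have {}E1 : \int[spacetime_measure]_z (D1 z - (A1 z + B1 z)) = 0.
  rewrite /Rintegral -integral_cylinder; last first.
    move=> z /out; rewrite /D1 /A1 /B1.
    by case=> [[-> ->]|[-> _ -> _ _]]; rewrite ?(mulr0, mul0r) addr0 subr0.
  rewrite -[RHS]/(fine 0%E) -E1; congr fine; apply: eq_integral => z _.
  rewrite dt_tensor ?laplacian_tensor //; [|by case: t1..].
  by congr EFin; rewrite /D1 /A1 /B1; ring.
have {}E2 : \int[spacetime_measure]_z (D2 z - (A2 z + B2 z)) = 0.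
  rewrite /Rintegral -integral_cylinder; last first.
    move=> z /out; rewrite /D2 /A2 /B2.
    by case=> [[-> ->]|[_ -> _ -> _]]; rewrite ?(mulr0, mul0r) addr0 subr0.
  rewrite -[RHS]/(fine 0%E) -E2; congr fine; apply: eq_integral => z _.
  rewrite dt_tensor ?laplacian_tensor //; [|by case: t2..].
  by congr EFin; rewrite /D2 /A2 /B2; ring.
rewrite (RintegralB measurableT iD1 (iD _ _ iA1 iB1)) in E1.
rewrite (RintegralD measurableT iA1 iB1) in E1.
rewrite (RintegralB measurableT iD2 (iD _ _ iA2 iB2)) in E2.
rewrite (RintegralD measurableT iA2 iB2) in E2.
have LE : \int[spacetime_measure]_z ((B1 z - D1 z) + (B2 z - D2 z)) <=
    \int[spacetime_measure]_z X z.
  apply: (le_Rintegral measurableT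
    (iD _ _ (iB _ _ iB1 iD1) (iB _ _ iB2 iD2)) iX).
  move=> z _; rewrite /X mul1r.
  have -> : B1 z - D1 z + (B2 z - D2 z) =
    (u z * space_laplacian phi1 z.1 - v z `^ p * phi1 z.1 +
    (v z * space_laplacian phi2 z.1 - u z `^ q * phi2 z.1)) * eta z.2.
    exact: tensor_algebra.
  have [Qz|/out] := pselect (Q z); first exact: (ler_wpM2r (eta0 _) (bound Qz)).
  case=> [[e0 _]|[f1 f2 l1 l2 c0]]; first by rewrite e0 !mulr0.
  by rewrite f1 f2 l1 l2 c0 !mulr0 subrr addr0 !mul0r.
rewrite (RintegralD measurableT (iB _ _ iB1 iD1) (iB _ _ iB2 iD2)) in LE.
rewrite (RintegralB measurableT iB1 iD1) (RintegralB measurableT iB2 iD2) in LE.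
pose G (z : ST) := A1 z + A2 z + X z.
have iG : spacetime_measure.-integrable setT (EFin \o G).
  exact: (iD _ _ (iD _ _ iA1 iA2) iX).
have GE : \int[spacetime_measure]_z G z = \int[spacetime_measure]_z A1 z +
    \int[spacetime_measure]_z A2 z + \int[spacetime_measure]_z X z.
  rewrite -(RintegralD measurableT iA1 iA2).
  exact: (RintegralD measurableT (iD _ _ iA1 iA2) iX).
suff -> : \int[lebesgue_measure]_t (W t * 'D_1 eta t + C * eta t) =
    \int[spacetime_measure]_z G z
  by rewrite GE; exact: (sum_ge0 E1 E2 LE).
rewrite /Rintegral -(integral21_prod_meas1 iG); congr fine.
apply: eq_integral => t _ /=.
have [tab|tab] := boolP (a <= t <= b); last first.
  have e0 : eta t = 0 by apply: contrapT => /eqP /eab; apply/negP.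
  have d0 : 'D_1 eta t = 0 by apply: contrapT => /eqP /Dab; apply/negP.
  rewrite e0 d0 !mulr0 addr0; apply/esym; apply: integral0_eq => x _.
  by rewrite /G /A1 /A2 /X /= e0 d0 !mulr0 !addr0.
have [t0 tT] : 0 < t /\ (t%:E < T)%E.
  move/andP: tab => [at_ tb]; split; first exact: lt_le_trans at_.
  by apply: le_lt_trans bT; rewrite lee_fin.
have iu := mass_integrable oO cu T1 t0 tT.
have iv := mass_integrable oO cv T2 t0 tT.
have ichi : (lebesgue_rV N).-integrable setT (EFin \o chi).
  have [cc [kc _]] := cchi.
  apply: (continuous_integrable kc (lebesgue_rV_compact kc) cc) => x xc.
  exact: subset_closure.
have iZ (f : 'rV[R]_N -> R) k : (lebesgue_rV N).-integrable setT (EFin \o f) ->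
    (lebesgue_rV N).-integrable setT (EFin \o (fun x => k * f x)).
  move=> f_int; rewrite (_ : _ \o _ = fun x => (k%:E * (f x)%:E)%E) //.
  exact: integrableZl.
have iS (f g : 'rV[R]_N -> R) : (lebesgue_rV N).-integrable setT (EFin \o f) ->
    (lebesgue_rV N).-integrable setT (EFin \o g) ->
    (lebesgue_rV N).-integrable setT (EFin \o (fun x => f x + g x)).
  move=> f_int g_int.
  rewrite (_ : _ \o _ = fun x => ((f x)%:E + (g x)%:E)%E) //;
    exact: integrableD.
pose F x := 'D_1 eta t * (u (x, t) * phi1 x) + 'D_1 eta t *
  (v (x, t) * phi2 x) +
  eta t * chi x.
have iF1 := iZ _ ('D_1 eta t) iu.
have iF2 := iZ _ ('D_1 eta t) iv.
have iF3 := iZ _ (eta t) ichi.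
transitivity (\int[lebesgue_rV N]_x F x)%:E.
  congr EFin; rewrite /F (RintegralD measurableT (iS _ _ iF1 iF2) iF3).
  rewrite (RintegralD measurableT iF1 iF2).
  rewrite (RintegralZl _ measurableT iu) (RintegralZl _ measurableT iv).
  rewrite (RintegralZl _ measurableT ichi) -mulrDr mulrC.
  by congr (_ + _); rewrite mulrC.
rewrite /Rintegral fineK; last first.
  exact: (integrable_fin_num _ (iS _ _ (iS _ _ iF1 iF2) iF3)).
apply: eq_integral => x _; congr EFin; exact: slice_algebra.
Qed.

(** The continuity of [W] turns the weak inequality into a bound at every pair
    of times. *)
Lemma weighted_mass_le s t : 0 < s -> s < t -> (t%:E < T)%E -> 0 <= C ->
  W t - W s <= C * (t - s).
Proof.
move=> s0 st tT C0; apply: (@weak_derivative_le _ T) => //.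
- move=> r r0 rT; apply: continuousD.
    by apply: (continuous_mass oO cu) => //; exact: test_function_Cc0.
  by apply: (continuous_mass oO cv) => //; exact: test_function_Cc0.
- exact: tested_weak_inequality.
Qed.

End tested.
End weak_formulation.

(** * Cutoffs and uniform approximation *)

Section cutoffs.
Context {R : realType} {N : nat}.
Implicit Types (K W : set 'rV[R]_N) (f : 'rV[R]_N -> R).

Lemma test_function_sub (V : normedModType R) (A B : set V) (f : V -> R) :
  A `<=` B -> test_function A f -> test_function B f.
Proof. by move=> AB [sf [kf fA]]; split => //; split => //;
  exact: subset_trans AB. Qed.

Lemma test_function_ball (c y : 'rV[R]_N) (r e : R) f : smooth_on setT f ->
  0 <= r -> (forall x, f x != 0 -> `|x - c| <= r) -> `|y - c| + r < e ->
  test_function (ball y e) f.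
Proof.
move=> sf r0 fr yc; split => //.
have cb := compact_ball_rV (a := c) r0;
  apply: (@compact_support_inW R _ _ (ball y e) f cb) => // x /= xr.
rewrite ball_rVE; apply: le_lt_trans yc.
have -> : y - x = (y - c) + (c - x) by rewrite addrA subrK.
by apply: le_trans (ler_normD _ _) _; rewrite lerD2l distrC.
Qed.

Lemma compact_norm_bound K : compact K -> exists2 M : R, 0 < M &
  forall y, K y -> `|y| <= M.
Proof.
move=> cK; have cn : {within K, continuous (fun y : 'rV[R]_N => `|y| : R)}.
  by apply: continuous_subspaceT => x; exact: norm_continuous.
have [M M0 HM] := compact_bound cK cn.
by exists M => // y /HM; rewrite normr_id.
Qed.

(** The pieces are kept apart because the convergence of masses is first known
    for functions supported in small balls only; it then follows for the whole
    plateau by summation. *)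
Lemma smooth_cutoff_sum K (e : R) : compact K -> 0 < e ->
  exists (I : finType) (P : pred I) (theta : I -> 'rV[R]_N -> R),
    [/\ forall i x, 0 <= theta i x,
        forall i, P i -> exists2 y, K y & test_function (ball y e) (theta i),
        forall x, \sum_(i | P i) theta i x <= 1 &
        exists2 h : R, 0 < h & forall x y, K y -> `|x - y| <= h ->
          \sum_(i | P i) theta i x = 1].
Proof.
move=> cK e0.
(* Pieces of radius [h] centred within [2 * h] of [K]: all those that meet the
   [h]-neighbourhood of [K], each inside a ball of radius [3 * h < e]. *)
pose h := e / 4; have h0 : 0 < h by rewrite divr_gt0.
have [M M0 HM] := compact_norm_bound cK.
have [I [c [theta [st t0 tc tS]]]] := partition_of_unity N (M + 4 * h) h0.
pose P i := `[< exists2 y, K y & `|y - c i| <= 2 * h >].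
exists I, P, theta; split => //.
- move=> i /asboolP[y Ky yc]; exists y => //.
  apply: (@test_function_ball (c i) _ h) => //; first exact: ltW.
    by move=> x; exact: tc.
  by rewrite /h in yc *; lra.
- move=> x; have [xB|xB] := leP `|x| (M + 4 * h).
    rewrite -(tS x xB) [leRHS](bigID P) /= lerDl; exact: sumr_ge0.
  rewrite big1 // => i /asboolP[y Ky yc]; apply: contrapT => /eqP /tc xc.
  have := ler_normD (x - y) y; have := ler_distD (c i) x y.
  by rewrite subrK [`|c i - y|]distrC; have := HM y Ky; lra.
- exists h => // x y Ky xy; rewrite -(tS x); last first.
    by have := ler_normD (x - y) y; rewrite subrK; have := HM y Ky; lra.
  rewrite [RHS](bigID P) /= [X in _ + X]big1 ?addr0 // => i /asboolP nP.
  apply: contrapT => /eqP /tc xc; apply: nP; exists y => //.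
  by have := ler_distD x y (c i); rewrite [`|y - x|]distrC; lra.
Qed.

Lemma test_function_sum (V : normedModType R) (W : set V) (I : Type) (s : seq I)
    (P : pred I) (F : I -> V -> R) : (forall i, P i -> test_function W (F i)) ->
  test_function W (fun x => \sum_(i <- s | P i) F i x).
Proof.
move=> tF; elim: s => [|i s IH].
  rewrite [X in test_function _ X](_ : _ = fun=> 0).
    by split; [exact: smooth_cst|case: (@Cc0_cst0 R V W)].
  by apply/funext => x; rewrite big_nil.
have [Pi|Pi] := boolP (P i).
  rewrite [X in test_function _ X](_ : _ = fun x =>
    F i x + \sum_(j <- s | P j) F j x).
    by apply: test_functionD => //; exact: tF.
  by apply/funext => x; rewrite big_cons Pi.
rewrite [X in test_function _ X](_ : _ = fun x => \sum_(j <- s | P j) F j x) //.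
by apply/funext => x; rewrite big_cons (negbTE Pi).
Qed.

Lemma smooth_cutoff K W : compact K -> open W -> K `<=` W ->
  exists (chi : 'rV[R]_N -> R) (h : R),
    [/\ test_function W chi, forall x, 0 <= chi x <= 1, 0 < h &
        forall x y, K y -> `|x - y| <= h -> chi x = 1].
Proof.
move=> cK oW KW; have [e e0 eW] := compact_nbhs_sub cK oW KW.
have [I [P [theta [t0 tK t1 [h h0 th]]]]] := smooth_cutoff_sum cK e0.
exists (fun x => \sum_(i | P i) theta i x), h; split => //.
- apply: (test_function_sum (index_enum I) (P := P) (F := theta)).
  by move=> i /tK[y Ky]; apply: test_function_sub; exact: eW.
- by move=> x; rewrite t1 andbT; exact: sumr_ge0.
Qed.

(** The coefficients are the values of [f] at the nodes of a partition of unity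
    of small mesh. The error and the sum itself vanish away from the support of
    [f], so that the error is later bounded by a small multiple of a plateau. *)
Lemma smooth_approx W f (d e : R) : Cc0 W f -> 0 < d -> 0 < e ->
  exists (I : finType) (P : pred I) (a : I -> R) (theta : I -> 'rV[R]_N -> R),
    (forall i, P i -> exists2 y, closure [set x | f x != 0] y &
       test_function (ball y e) (theta i)) /\
    (forall x, `|f x - \sum_(i | P i) a i * theta i x| <= d) /\
    (forall x, f x != 0 \/ \sum_(i | P i) a i * theta i x != 0 ->
       exists2 y, closure [set x | f x != 0] y & `|x - y| <= e).
Proof.
move=> [cf [kf fW]] d0 e0; set K := closure _ in kf fW *.
have fK x : f x != 0 -> K x by move=> fx; exact: subset_closure.
have [r r0 Hr] : exists2 r : R, 0 < r & forall y, K y ->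
    (fun A : set 'rV[R]_N => forall x z, A x -> A z -> `|f x - f z| <= d)
      (ball y r).
  apply: (lebesgue_number (P := fun A => forall x z, A x -> A z -> `|f x - f z|
    <= d)) => //.
    by move=> A B AB HB x z Ax Az; apply: HB; exact: AB.
  move=> x Kx; have /cvgrPdist_le /(_ (d / 2)) := cf x;
    rewrite divr_gt0 // => /(_ isT).
  rewrite -nbhs_ballE => -[r /= r0 rf]; exists r => // y z /rf /= fy /rf /= fz.
  by have := ler_distD (f x) (f y) (f z); rewrite [`|f y - f x|]distrC; lra.
pose h := Num.min (r / 2) (e / 2).
have h0 : 0 < h by rewrite lt_min !divr_gt0.
have hr : h < r by rewrite /h gt_min ltr_pdivrMr // ltr_pMr // ltr1n.
have he : h < e by rewrite /h gt_min [X in _ || X]ltr_pdivrMr // ltr_pMr //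
  ltr1n // orbT.
have [M M0 HM] := compact_norm_bound kf.
have [I [c [theta [st t0 tc tS]]]] := partition_of_unity N (M + e) h0.
pose P i := f (c i) != 0.
have PK i : P i -> K (c i) by move=> Pi; exact: subset_closure.
exists I, P, (fun i => f (c i)), theta; split; [|split].
- move=> i /PK Kc; exists (c i) => //.
  apply: (@test_function_ball (c i) _ h) => //; first exact: ltW.
    by move=> x; exact: tc.
  by rewrite subrr normr0 add0r.
- move=> x; have -> : \sum_(i | P i) f (c i) * theta i x = \sum_i f (c i) *
  theta i x.
    rewrite [RHS](bigID P) /= [X in _ + X]big1 ?addr0 // => i.
    by rewrite negbK => /eqP ->; rewrite mul0r.
  have near_le i : theta i x != 0 -> `|f x - f (c i)| <= d.
    move=> /tc xc; have [fx|fx] := eqVneq (f x) 0; last first.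
      apply: (Hr x) => //; first exact: subset_closure.
        exact: ballxx.
      by rewrite ball_rVE (le_lt_trans xc).
    have [fc|fc] := eqVneq (f (c i)) 0; first by rewrite fx fc subrr normr0 ltW.
    apply: (Hr (c i)) => //; first exact: subset_closure.
      by rewrite ball_rVE distrC (le_lt_trans xc).
    exact: ballxx.
  have [xB|xB] := leP `|x| (M + e).
    rewrite -[f x]mulr1 -(tS x xB) mulr_sumr -sumrB.
    apply: le_trans (ler_norm_sum _ _ _) _.
    rewrite -[d]mulr1 -(tS x xB) mulr_sumr; apply: ler_sum => i _.
    rewrite -mulrBl normrM (ger0_norm (t0 _ _)).
    have [->|/near_le] := eqVneq (theta i x) 0; first by rewrite !mulr0.
    exact: ler_wpM2r.
  have fx0 : f x = 0.
    apply: contrapT => /eqP fx; have := HM x (fK x fx); lra.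
  rewrite fx0 big1 ?subrr ?normr0 ?(ltW d0) // => i _.
  have [->|/tc xc] := eqVneq (theta i x) 0; first by rewrite mulr0.
  have [->|fc] := eqVneq (f (c i)) 0; first by rewrite mul0r.
  have := HM _ (PK _ fc); have := ler_normD (x - c i) (c i); rewrite subrK; lra.
- move=> x [fx|sx]; first by exists x;
  [exact: subset_closure|rewrite subrr normr0 ltW].
  have [i Pi ti] : exists2 i, P i & theta i x != 0.
    apply: contrapT => nx; move/negP: sx; apply; rewrite big1 // => i Pi.
    have [->|ti] := eqVneq (theta i x) 0; first by rewrite mulr0.
    by exfalso; apply: nx; exists i.
  by exists (c i); [exact: PK|rewrite (le_trans (tc _ _ ti)) // ltW].
Qed.

End cutoffs.

(** * Absorption against diffusion *)

Section absorption.
Context {R : realType}.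

(** The absorption [x^r] beats a linear term even with the loss of two powers
    of the cutoff [a]: where it does not, [x * a^k] itself is bounded. *)
Lemma absorb_linear (r A : R) (k : nat) : 1 < r -> 2 <= k%:R * (r - 1) ->
  0 <= A -> exists2 K : R, 0 <= K & forall x a : R, 0 < x -> 0 <= a <= 1 ->
  A * (x * a ^+ k) <= x `^ r * a ^+ k.+2 + K.
Proof.
move=> r1 kr A0; have r10 : 0 < r - 1 by rewrite subr_gt0.
exists (A * A `^ (r - 1)^-1); first by rewrite mulr_ge0 // powR_ge0.
move=> x a x0 /andP[a0 a1].
have k0 : (0 < k)%N.
  by case: k kr => //; rewrite mul0r; lra.
have [->|an0] := eqVneq a 0.
  by rewrite !expr0n /= (gtn_eqF k0) !mulr0 add0r mulr_ge0 // powR_ge0.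
have {an0}a0 : 0 < a by rewrite lt_def an0.
have ak0 : 0 < a ^+ k by rewrite exprn_gt0.
have xr : x `^ r = x * x `^ (r - 1).
  by rewrite mulr_powRB1 ?(ltW x0) // (lt_trans ltr01).
have [Aa|Aa] := leP A (x `^ (r - 1) * a ^+ 2).
  apply: ler_wpDr; first by rewrite mulr_ge0 // powR_ge0.
  rewrite xr !exprS (_ : x * x `^ (r - 1) * (a * (a * a ^+ k)) =
    (x `^ (r - 1) * a ^+ 2) * (x * a ^+ k)); last by ring.
  by rewrite ler_wpM2r // mulr_ge0 // ltW.
apply: ler_wpDl; first by rewrite mulr_ge0 ?powR_ge0 ?exprn_ge0 // ltW.
rewrite ler_wpM2l //.
have y0 : 0 < x * a ^+ k by rewrite mulr_gt0.
have -> : x * a ^+ k = ((x * a ^+ k) `^ (r - 1)) `^ (r - 1)^-1.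
  by rewrite -powRrM mulfV ?powRr1 ?(ltW y0) // lt0r_neq0.
apply: ge0_ler_powR; rewrite ?nnegrE ?invr_ge0 ?powR_ge0 ?(ltW r10) //.
apply: le_trans (ltW Aa).
rewrite powRM ?(ltW x0) ?(ltW ak0) // ler_wpM2l ?powR_ge0 //.
rewrite -powR_mulrn ?(ltW a0) // -powRrM -powR_mulrn ?(ltW a0) //.
by rewrite ger_powR // a0.
Qed.

End absorption.

Section cutoff_powers.
Context {R : realType} {N : nat}.
Implicit Types psi : 'rV[R]_N -> R.

Lemma derive_pow psi m x v : smooth_on setT psi ->
  'D_v (fun x => psi x ^+ m.+1) x = m.+1%:R * psi x ^+ m * 'D_v psi x.
Proof.
move=> sp; have := @deriveX R _ psi m.+1 x v (smooth_derivable sp).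
by rewrite exprfctE.
Qed.

Lemma derive2_pow psi m x v : smooth_on setT psi ->
  'D_v ('D_v (fun x => psi x ^+ m.+2)) x = psi x ^+ m *
  (m.+2%:R * m.+1%:R * ('D_v psi x) ^+ 2 + m.+2%:R * psi x * 'D_v ('D_v psi) x).
Proof.
move=> sp; have -> : 'D_v (fun x => psi x ^+ m.+2) =
    fun x => (m.+2%:R * psi x ^+ m.+1) * 'D_v psi x.
  by apply/funext => y; exact: derive_pow.
rewrite [LHS]deriveM; last 2 first.
- exact/smooth_derivable/smoothZ/smoothX.
- exact/smooth_derivable/smooth_derive.
rewrite (_ : 'D_v (fun x => m.+2%:R * psi x ^+ m.+1) x =
    m.+2%:R * (m.+1%:R * psi x ^+ m * 'D_v psi x)); last first.
  rewrite -derive_pow //.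
  by apply: (@deriveMl R _ (fun x => psi x ^+ m.+1));
    exact/smooth_derivable/smoothX.
by rewrite /GRing.scale /= !exprS; ring.
Qed.

Lemma Cc0_bounded (V : normedModType R) (W : set V) (f : V -> R) : Cc0 W f ->
  exists2 M : R, 0 < M & forall x, `|f x| <= M.
Proof.
move=> [cf [kf _]]; have [M M0 HM] := compact_bound kf
  (continuous_subspaceT cf).
exists M => // x; have [->|fx] := eqVneq (f x) 0; first by rewrite normr0 ltW.
by apply: HM; exact: subset_closure.
Qed.

Lemma laplacian_pow_bound (W : set 'rV[R]_N) psi m : test_function W psi ->
  (forall x, 0 <= psi x <= 1) -> exists2 A : R, 0 <= A &
  forall x, `|space_laplacian (fun x => psi x ^+ m.+2) x| <= A * psi x ^+ m.
Proof.
move=> tp p01; have sp := tp.1.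
pose F x := \sum_(i < N) (m.+2%:R * m.+1%:R * ('D_(delta_mx 0 i) psi x) ^+ 2 +
  m.+2%:R * psi x * 'D_(delta_mx 0 i) ('D_(delta_mx 0 i) psi) x).
have cF : Cc0 W F.
  apply: Cc0_sum => i; apply: Cc0D.
    rewrite [X in Cc0 _ X](_ : _ = fun x =>
      (m.+2%:R * m.+1%:R * 'D_(delta_mx 0 i) psi x) *
      'D_(delta_mx 0 i) psi x); last by apply/funext => x; ring.
    apply: Cc0Ml; last exact/test_function_Cc0/test_function_derive.
    exact/smooth_continuous/smoothZ/smooth_derive.
  apply: Cc0Ml; first exact/smooth_continuous/smoothZ.
  exact/test_function_Cc0/test_function_derive/test_function_derive.
have [A A0 HA] := Cc0_bounded cF; exists A; first exact: ltW.
move=> x; have /andP[px _] := p01 x.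
rewrite (_ : space_laplacian _ x = psi x ^+ m * F x); last first.
  by rewrite /space_laplacian mulr_sumr; apply: eq_bigr => i _;
    exact: derive2_pow.
by rewrite normrM ger0_norm ?exprn_ge0 // mulrC ler_wpM2r ?exprn_ge0.
Qed.

End cutoff_powers.

(** * Limits of masses near a regular point *)

Section local_limits.
Context {R : realType} {N : nat}.

Lemma space_laplacianZD (f g : 'rV[R]_N -> R) (a : R) x :
  smooth_on setT f -> smooth_on setT g ->
  space_laplacian (fun y => a * f y + g y) x =
  a * space_laplacian f x + space_laplacian g x.
Proof.
move=> sf sg; rewrite /space_laplacian mulr_sumr -big_split /=.
have D (f1 g1 : 'rV[R]_N -> R) v y : smooth_on setT f1 -> smooth_on setT g1 ->
    'D_v (fun y => a * f1 y + g1 y) y = a * 'D_v f1 y + 'D_v g1 y.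
  move=> sf1 sg1; rewrite [LHS]deriveD; last 2 first.
  - exact/smooth_derivable/smoothZ.
  - exact: smooth_derivable.
  congr (_ + _); apply: (@deriveMl R _ f1); exact: smooth_derivable.
apply: eq_bigr => i _; set e := delta_mx _ _.
rewrite (_ : 'D_e (fun y => a * f y + g y) = fun y => a * 'D_e f y + 'D_e g y).
  by apply: D; exact: smooth_derive.
by apply/funext => y; exact: D.
Qed.

Lemma space_laplacian0 (x : 'rV[R]_N) : space_laplacian (fun=> 0 : R) x = 0.
Proof.
rewrite /space_laplacian big1 // => i _.
rewrite (_ : 'D_ _ (fun=> 0) = fun=> 0) ?derive_cst //.
by apply/funext => y; rewrite derive_cst.
Qed.

Lemma space_laplacianZ (f : 'rV[R]_N -> R) (a : R) x : smooth_on setT f ->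
  space_laplacian (fun y => a * f y) x = a * space_laplacian f x.
Proof.
move=> sf; have E : (fun y => a * f y) = (fun y => a * f y + 0).
  by apply/funext => y; rewrite addr0.
rewrite E; have := @space_laplacianZD f (fun=> 0) a x sf (smooth_cst 0).
by rewrite space_laplacian0 addr0.
Qed.

Lemma cvg_at_right0_almost_monotone (f : R -> R) (T1 C M : R) : 0 < T1 ->
  (forall s t, 0 < s -> s < t -> t < T1 -> f t - f s <= C * (t - s)) ->
  (forall t, 0 < t -> t < T1 -> f t <= M) -> cvg (f t @[t --> 0^'+]).
Proof.
move=> T10 fC fM; pose h t := f t - C * t.
have ch : cvg (h t @[t --> 0^'+]).
  apply/cvg_ex; eexists; apply: (@nonincreasing_at_right_cvgr _ h 0 (BLeft T1)).
  - by rewrite bnd_simp.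
  - move=> s t; rewrite !in_itv /= => /andP[s0 sT] /andP[t0 tT].
    rewrite le_eqVlt => /predU1P[->//|ts]; have := fC _ _ s0 ts tT.
    by rewrite /h; lra.
  - exists (M + `|C| * T1) => _ [t /= + <-]; rewrite in_itv /= => /andP[t0 tT].
    rewrite /h lerD ?fM // -mulNr (le_trans (ler_norm _)) // normrM normrN.
    by rewrite ler_wpM2l // gtr0_norm // ltW.
rewrite (_ : (fun t => f t) = fun t => h t + C * t); last first.
  by apply/funext => t; rewrite /h subrK.
apply: is_cvgD => //; apply/cvg_ex; exists (C * 0).
apply: cvgM; first exact: cvg_cst.
by apply: cvg_at_right_filter; exact: cvg_id.
Qed.

(** Bundled so that exchanging the two unknowns, together with the exponents, is
    a symmetry; every estimate is then needed for the first unknown only. *)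
Definition heat_pair (p q : R) (Omega : set 'rV[R]_N) (T : \bar R)
    (u v : 'rV[R]_N * R -> R) :=
  [/\ positive_solution p q (cylinder Omega T) u v,
      smooth_on (cylinder Omega T) u & smooth_on (cylinder Omega T) v].

Lemma heat_pair_sym p q Omega T u v :
  heat_pair p q Omega T u v -> heat_pair q p Omega T v u.
Proof.
move=> [[u0 v0 Lu Lv W] su sv]; split; [split|exact: sv|exact: su].
- exact: v0.
- exact: u0.
- exact: Lv.
- exact: Lu.
- by move=> phi tp; have [Wu Wv] := W phi tp; split; [exact: Wv|exact: Wu].
Qed.

Section pair.
Variables (p q : R) (Omega : set 'rV[R]_N) (T : \bar R).
Variables (u v : 'rV[R]_N * R -> R).
Hypotheses (p1 : 1 < p) (q1 : 1 < q) (oO : open Omega).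
Hypothesis (hp : heat_pair p q Omega T u v).

Let huv : positive_solution p q (cylinder Omega T) u v. Proof. by case: hp. Qed.
Let hu : smooth_on (cylinder Omega T) u. Proof. by case: hp. Qed.
Let hv : smooth_on (cylinder Omega T) v. Proof. by case: hp. Qed.
Let cu z : cylinder Omega T z -> {for z, continuous u}. Proof.
exact: (hu 0). Qed.
Let cv z : cylinder Omega T z -> {for z, continuous v}. Proof.
exact: (hv 0). Qed.
Let u_gt0 z : cylinder Omega T z -> 0 < u z. Proof.
by case: huv => + _ _ _ _; apply. Qed.
Let v_gt0 z : cylinder Omega T z -> 0 < v z. Proof.
by case: huv => _ + _ _ _; apply. Qed.

Let absorb_algebra (U V Uq Vp k A B a g f l m K1 K2 : R) :
  0 < U -> 0 < V -> 0 <= Uq -> 0 <= Vp -> k = B + 1 -> 0 <= B -> 0 <= A ->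
    0 <= a -> 0 <= g <= a ->
  `|f| <= B * g -> `|m| <= B * g -> `|l| <= A * a ->
  (k * A + B) * (U * a) <= Uq * g + K1 ->
  (k * A) * (V * a) <= Vp * g + K2 ->
  U * (k * l + m) - Vp * (k * g + f) + (V * (k * l) - Uq * (k * g)) <= K1 + K2.
Proof.
move=> U0 V0 Uq0 Vp0 kE B0 A0 a0 /andP[g0 ga] fB mB lA H1 H2.
have k0 : 0 <= k by rewrite kE addr_ge0.
have h1 : U * (k * l) <= U * (k * (A * a)).
  by rewrite ler_wpM2l ?(ltW U0) // ler_wpM2l // (le_trans (ler_norm _)).
have h2 : V * (k * l) <= V * (k * (A * a)).
  by rewrite ler_wpM2l ?(ltW V0) // ler_wpM2l // (le_trans (ler_norm _)).
have h3 : U * m <= U * (B * a).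
  rewrite ler_wpM2l ?(ltW U0) // (le_trans (ler_norm _)) // (le_trans mB) //.
  exact: ler_wpM2l.
have h4 : Vp * (- f) <= Vp * (B * g).
  by rewrite ler_wpM2l // (le_trans (ler_norm _)) // normrN.
have h5 : Uq * g <= Uq * (k * g).
  by rewrite ler_wpM2l // ler_peMl // kE lerDr.
have h6 : Vp * (k * g) = Vp * (B * g) + Vp * g by rewrite kE; ring.
by lra.
Qed.

(** The weight [B + 1] is the point: after [B] copies of the absorption terms
    have compensated [phi], one full copy is left to absorb the diffusion terms.
    With [phi = 0] and [B = 0] this is the almost monotonicity of the total
    mass. *)
Lemma key_monotone psi phi B (k : nat) :
  test_function Omega psi -> (forall x, 0 <= psi x <= 1) ->
  test_function Omega phi -> 0 <= B ->
  (forall x, `|phi x| <= B * psi x ^+ k.+2) ->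
  (forall x, `|space_laplacian phi x| <= B * psi x ^+ k.+2) ->
  2 <= k%:R * (p - 1) -> 2 <= k%:R * (q - 1) ->
  exists2 C : R, 0 <= C & forall s t, 0 < s -> s < t -> (t%:E < T)%E ->
    let W r := mass u (fun x => (B + 1) * psi x ^+ k.+2 + phi x) r +
               mass v (fun x => (B + 1) * psi x ^+ k.+2) r in
    W t - W s <= C * (t - s).
Proof.
move=> tpsi p01 tphi B0 phiB lapB kp kq.
have [A A0 HA] := laplacian_pow_bound k tpsi p01.
have k0 : (0 < k)%N by case: k kp {phiB lapB kq HA} => //; rewrite mul0r; lra.
have BA0 : 0 <= (B + 1) * A by rewrite mulr_ge0 // addr_ge0.
have [K1 K10 HK1] := absorb_linear q1 kq (addr_ge0 BA0 B0).
have [K2 K20 HK2] := absorb_linear p1 kp BA0.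
have [spsi [kpsi psiO]] := tpsi.
have [theta [h [ttheta th01 h0 thK]]] := smooth_cutoff kpsi oO psiO.
pose g x := psi x ^+ k.+2.
have tg : test_function Omega g.
  split; first exact: smoothX.
  by apply: compact_support_hull (tpsi.2) _ => x px; rewrite /g px expr0n.
pose chi x := (K1 + K2) * theta x.
have cchi : Cc0 Omega chi by apply: Cc0Z; exact: test_function_Cc0.
exists (\int[lebesgue_rV N]_x chi x).
  apply: Rintegral_ge0 => x _; have /andP[th0 _] := th01 x.
  by rewrite mulr_ge0 // addr_ge0.
move=> s t s0 st tT /=.
have t1 : test_function Omega (fun x => (B + 1) * g x + phi x).
  by apply: test_functionD => //; exact: test_functionZ.
have t2 : test_function Omega (fun x => (B + 1) * g x) by exact: test_functionZ.
apply: (weighted_mass_le oO huv hu hv t1 t2 cchi) => //; last first.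
  apply: Rintegral_ge0 => x _; have /andP[th0 _] := th01 x.
  by rewrite mulr_ge0 // addr_ge0.
move=> z Qz; rewrite space_laplacianZD //; [|by case: tg|by case: tphi].
rewrite (_ : space_laplacian (fun x => (B + 1) * g x) z.1 =
    (B + 1) * space_laplacian g z.1); last first.
  exact: space_laplacianZ tg.1.
have [px|px] := eqVneq (psi z.1) 0.
  have g0 : g z.1 = 0 by rewrite /g px expr0n.
  have f0 : phi z.1 = 0.
    by apply/eqP; rewrite -normr_le0 (le_trans (phiB _)) // px expr0n mulr0.
  have m0 : space_laplacian phi z.1 = 0.
    by apply/eqP; rewrite -normr_le0 (le_trans (lapB _)) // px expr0n mulr0.
  have l0 : space_laplacian g z.1 = 0.
    apply/eqP; rewrite -normr_le0 (le_trans (HA _)) // px expr0n.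
    by rewrite (gtn_eqF k0) mulr0.
  rewrite g0 f0 m0 l0 !(mulr0, addr0, subr0); have /andP[th0 _] := th01 z.1.
  by rewrite mulr_ge0 // addr_ge0.
have pK : closure [set x | psi x != 0] z.1 by exact: subset_closure.
have -> : chi z.1 = K1 + K2.
  by rewrite /chi (thK _ _ pK) ?mulr1 // subrr normr0 ltW.
have /andP[px0 px1] := p01 z.1.
apply: (absorb_algebra (u_gt0 Qz) (v_gt0 Qz) (powR_ge0 _ _) (powR_ge0 _ _)
  (erefl (B + 1)) B0 A0 (exprn_ge0 k px0) _ (phiB _) (lapB _) (HA _)
  (HK1 _ _ (u_gt0 Qz) (p01 _)) (HK2 _ _ (v_gt0 Qz) (p01 _))).
by rewrite exprn_ge0 //= !exprS mulrA ler_piMl ?exprn_ge0 // mulr_ile1.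
Qed.

Lemma mass_le_integral (U : set 'rV[R]_N) g t : open U -> U `<=` Omega ->
  Cc0 U g -> (forall x, 0 <= g x <= 1) -> 0 < t -> (t%:E < T)%E ->
  ((mass u g t + mass v g t)%:E <=
   \int[lebesgue_rV N]_(x in U) (u (x, t) + v (x, t))%:E)%E.
Proof.
move=> oU UO cg g01 t0 tT; have cgO : Cc0 Omega g.
  by case: cg => c [k s]; split => //; split => //; exact: subset_trans UO.
have iu := mass_integrable oO cu cgO t0 tT.
have iv := mass_integrable oO cv cgO t0 tT.
have iuv : (lebesgue_rV N).-integrable setT
    (EFin \o (fun x => u (x, t) * g x + v (x, t) * g x)).
  rewrite (_ : _ \o _ = fun x =>
    ((u (x, t) * g x)%:E + (v (x, t) * g x)%:E)%E) //.
  exact: integrableD.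
rewrite -(RintegralD measurableT iu iv) /Rintegral fineK; last first.
  exact: (integrable_fin_num _ iuv).
have Q x : U x -> cylinder Omega T (x, t) by move=> /UO Ox.
have gU x : ~ U x -> g x = 0.
  move=> Ux; apply: contrapT => /eqP gx; apply: Ux.
  by case: cg => _ [_]; apply; exact: subset_closure.
rewrite (_ : (\int[_]_x _)%E =
    (\int[lebesgue_rV N]_(x in U) (u (x, t) * g x + v (x, t) * g x)%:E)%E).
  have cuU x : U x -> {for x, continuous (fun y => u (y, t))}.
    by move=> /UO; exact: (continuous_slice_space t0 tT cu).
  have cvU x : U x -> {for x, continuous (fun y => v (y, t))}.
    by move=> /UO; exact: (continuous_slice_space t0 tT cv).
  have mu := open_continuous_measurable_rV oU cuU.
  have mv := open_continuous_measurable_rV oU cvU.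
  have mg : measurable_fun U g.
    by apply: open_continuous_measurable_rV => // x _; exact: cg.1.
  apply: ge0_le_integral.
  - exact: open_measurable_rV.
  - move=> x Ux; have /andP[g0 _] := g01 x.
    by rewrite lee_fin -mulrDl mulr_ge0 // addr_ge0 // ltW ?u_gt0 ?v_gt0 //;
      exact: Q.
  - by apply/measurable_EFinP; apply: measurable_funD; exact: measurable_funM.
  - by apply/measurable_EFinP; exact: measurable_funD.
  - move=> x Ux; rewrite lee_fin -mulrDl; have /andP[_ g1] := g01 x.
    by rewrite ler_piMr // addr_ge0 // ltW ?u_gt0 ?v_gt0 //; exact: Q.
rewrite [RHS]integral_mkcond; apply: eq_integral => x _; rewrite patchE.
by case: ifPn => // /negP nU; rewrite gU ?mulr0 ?addr0 // => /mem_set.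
Qed.

(** At a point where the total mass does not blow up, it stays bounded along a
    sequence of times, hence up to time 0 by almost monotonicity; the almost
    monotone quantities of the key inequality then have limits. *)
Lemma regular_point_limit (x0 : 'rV[R]_N) (U : set 'rV[R]_N) : (0 < T)%E ->
  open U -> U x0 -> U `<=` Omega ->
  ~ ((\int[lebesgue_rV N]_(x in U) (u (x, t) + v (x, t))%:E)%E
       @[t --> 0^'+] --> +oo%E) ->
  exists2 r : R, 0 < r & forall phi, test_function (ball x0 r) phi ->
    cvg (mass u phi t @[t --> 0^'+]).
Proof.
move=> T0 oU Ux0 UO nblow.
have [T1 T10 T1T] : exists2 T1, 0 < T1 & (T1%:E < T)%E by exact: ex_time_gt.
have [psi [r [tpsiU p01 r0 pr]]] := smooth_cutoff (@compact_set1 _ x0) oU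
  (fun x (xx : x = x0) => eq_ind_r U Ux0 xx).
have tpsi := test_function_sub UO tpsiU.
have [k kp kq] : exists2 k : nat, 2 <= k%:R * (p - 1) & 2 <= k%:R * (q - 1).
  pose m := Num.min (p - 1) (q - 1).
  have m0 : 0 < m by rewrite lt_min !subr_gt0 p1.
  exists (Num.truncn (2 / m)).+1.
    apply: (@le_trans _ _ ((Num.truncn (2 / m)).+1%:R * m)).
      by rewrite -ler_pdivrMr // ltW // truncnS_gt.
    by rewrite ler_wpM2l // /m ge_min lexx.
  apply: (@le_trans _ _ ((Num.truncn (2 / m)).+1%:R * m)).
    by rewrite -ler_pdivrMr // ltW // truncnS_gt.
  by rewrite ler_wpM2l // /m ge_min lexx orbT.
pose g x := psi x ^+ k.+2.
have g01 x : 0 <= g x <= 1.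
  by have /andP[p0 p1'] := p01 x; rewrite exprn_ge0 //= exprn_ile1.
have cgU : Cc0 U g.
  split; first exact/smooth_continuous/smoothX/tpsiU.1.
  by apply: compact_support_hull (tpsiU.2) _ => x px; rewrite /g px expr0n.
have cg : Cc0 Omega g.
  by case: cgU => c [K s]; split => //; split => //; exact: subset_trans UO.
have t0fun : test_function Omega (fun=> 0 : R).
  by split; [exact: smooth_cst|case: (@Cc0_cst0 R _ Omega)].
have b1 x : `|0 : R| <= 0 * psi x ^+ k.+2 by rewrite normr0 mul0r.
have b2 x : `|space_laplacian (fun=> 0 : R) x| <= 0 * psi x ^+ k.+2.
  by rewrite space_laplacian0 normr0 mul0r.
have [C0 C00 H0] := key_monotone tpsi p01 t0fun (lexx 0) b1 b2 kp kq.
pose G t := mass u g t + mass v g t.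
have HG s t : 0 < s -> s < t -> (t%:E < T)%E -> G t - G s <= C0 * (t - s).
  move=> s0 st tT; have := H0 s t s0 st tT; rewrite /=.
  have -> : (fun x => (0 + 1) * psi x ^+ k.+2 + 0) = g.
    by apply/funext => x; rewrite addr0 add0r mul1r.
  by have -> : (fun x => (0 + 1) * psi x ^+ k.+2) = g;
    [apply/funext => x; rewrite add0r mul1r|].
pose I t := (\int[lebesgue_rV N]_(x in U) (u (x, t) + v (x, t))%:E)%E.
have [A HA] : exists A : R, ~ \forall t \near (0 : R)^'+, (A%:E <= I t)%E.
  apply: contrapT => h; apply: nblow; apply/cvgeyPge => A.
  by apply: contrapT => nA; apply: h; exists A.
have T1lt t : t < T1 -> (t%:E < T)%E.
  by move=> tT; apply: lt_trans T1T; rewrite lte_fin.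
have GM t : 0 < t -> t < T1 -> G t <= A + C0 * T1.
  move=> t0 tT.
  have [s [s0 st Is]] : exists s, [/\ 0 < s, s < t & (I s < A%:E)%E].
    apply: contrapT => ns; apply: HA; near=> s; rewrite leNgt; apply/negP => Is.
    by apply: ns; exists s; split => //; near: s; exact: nbhs_right_lt.
  have Gs : G s <= A.
    rewrite -lee_fin; apply: le_trans (ltW Is).
    apply: mass_le_integral => //; apply: T1lt; exact: lt_trans st _.
  have := HG s t s0 st (T1lt t tT).
  have : C0 * (t - s) <= C0 * T1 by rewrite ler_wpM2l //; lra.
  by lra.
have cG : cvg (G t @[t --> 0^'+]).
  apply: (@cvg_at_right0_almost_monotone G T1 C0 (A + C0 * T1)) => //.
  by move=> s t s0 st tT; apply: HG => //; exact: T1lt.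
exists r => // phi tphi.
have tphiO : test_function Omega phi.
  apply: test_function_sub tphi => x; rewrite ball_rVE => xr.
  apply/UO; have [_ [_ sU]] := cgU; apply/sU/subset_closure => /=.
  by rewrite /g (pr x x0) ?expr1n ?oner_eq0 // distrC ltW.
have [M1 M10 HM1] := Cc0_bounded (test_function_Cc0 tphi).
have [M2 M20 HM2] := Cc0_bounded (space_laplacian_Cc0 tphi).
pose B := M1 + M2.
have B0 : 0 <= B by rewrite addr_ge0 // ltW.
have on_ball (f : 'rV[R]_N -> R) M x : Cc0 (ball x0 r) f -> M <= B ->
    (forall x, `|f x| <= M) -> `|f x| <= B * psi x ^+ k.+2.
  move=> [_ [_ sf]] MB fM; have [->|fx] := eqVneq (f x) 0.
    by rewrite normr0 mulr_ge0 //; have /andP[] := g01 x.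
  have /sf : closure [set x | f x != 0] x by exact: subset_closure.
  rewrite ball_rVE => xr; rewrite (pr x x0) ?expr1n ?mulr1 //.
    exact: le_trans (fM x) MB.
  by rewrite distrC ltW.
have phiB x : `|phi x| <= B * psi x ^+ k.+2.
  apply: (on_ball phi M1) => //; first exact: test_function_Cc0.
  by rewrite lerDl ltW.
have lapB x : `|space_laplacian phi x| <= B * psi x ^+ k.+2.
  apply: (on_ball (space_laplacian phi) M2) => //;
    first exact: space_laplacian_Cc0.
  by rewrite lerDr ltW.
have [C1 C10 H1] := key_monotone tpsi p01 tphiO B0 phiB lapB kp kq.
have cphi := test_function_Cc0 tphiO.
pose F t := (B + 1) * G t + mass u phi t.
have HF s t : 0 < s -> s < t -> t < T1 -> F t - F s <= C1 * (t - s).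
  move=> s0 st tT; have := H1 s t s0 st (T1lt t tT); rewrite /=.
  have t0 := lt_trans s0 st; have sT := lt_trans st tT.
  have E x : 0 < x -> x < T1 ->
      mass u (fun y => (B + 1) * psi y ^+ k.+2 + phi y) x +
      mass v (fun y => (B + 1) * psi y ^+ k.+2) x = F x.
    move=> x_0 xT; have {}xT := T1lt x xT.
    rewrite (massD oO cu (Cc0Z (B + 1) cg) cphi) //.
    rewrite (massZ oO cu (B + 1) cg) // (massZ oO cv (B + 1) cg) //.
    by rewrite /F /G; lra.
  by rewrite !E.
have mass_ge0 w t : (forall z, cylinder Omega T z -> 0 < w z) -> 0 < t ->
  t < T1 ->
    0 <= mass w g t.
  move=> w0 t0 tT; apply: Rintegral_ge0 => x _.
  have [->|gx] := eqVneq (g x) 0; first by rewrite mulr0.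
  have /andP[gx0 _] := g01 x; rewrite mulr_ge0 //; apply/ltW/w0.
  split => /=; last by split => //; exact: T1lt.
  by case: cg => _ [_]; apply; exact: subset_closure.
have cF : cvg (F t @[t --> 0^'+]).
  apply: (@cvg_at_right0_almost_monotone F T1 C1
    ((B + 1 + B) * (A + C0 * T1))) => //.
  move=> t t0 tT; have tT' := T1lt t tT.
  have : mass u phi t <= B * mass u g t.
    rewrite -(massZ oO cu B cg) //.
    apply: (le_mass oO cu) => //; [by move=> z /u_gt0/ltW|exact: Cc0Z|].
    by move=> x; exact: le_trans (ler_norm _) (phiB x).
  have v0 := mass_ge0 v t v_gt0 t0 tT.
  have : B * mass u g t <= B * G t by rewrite ler_wpM2l // /G lerDl.
  have : (B + 1 + B) * G t <= (B + 1 + B) * (A + C0 * T1).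
    by rewrite ler_wpM2l ?GM //; lra.
  by rewrite /F; lra.
rewrite (_ : (fun t => mass u phi t) = fun t => F t - (B + 1) * G t).
  apply: is_cvgB; first exact: cF.
  by apply: is_cvgM; [exact: is_cvg_cst|exact: cG].
by apply/funext => t; rewrite /F addrAC subrr add0r.
Unshelve. all: by end_near. Qed.

End pair.
End local_limits.

(** * Limits against continuous functions *)

Section extension.
Context {R : realType} {N : nat}.
Variables (Omega RR : set 'rV[R]_N) (T : \bar R) (w : 'rV[R]_N * R -> R).
Hypotheses (oO : open Omega) (oRR : open RR) (RO : RR `<=` Omega)
  (T0 : (0 < T)%E).
Hypothesis cw : forall z, cylinder Omega T z -> {for z, continuous w}.
Hypothesis w0 : forall z, cylinder Omega T z -> 0 <= w z.

Let good f := Cc0 Omega f /\ cvg (mass w f t @[t --> 0^'+]).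

Lemma Cc0_sub (V : normedModType R) (A B : set V) (f : V -> R) :
  A `<=` B -> Cc0 A f -> Cc0 B f.
Proof. by move=> AB [c [k s]]; split => //; split => //;
  exact: subset_trans AB. Qed.

Lemma near_time : \forall t \near (0 : R)^'+, 0 < t /\ (t%:E < T)%E.
Proof.
have [T1 T10 T1T] := ex_time_gt T0; near=> t; split; first by [].
apply: lt_trans T1T; rewrite lte_fin; near: t; exact: nbhs_right_lt.
Unshelve. all: by end_near. Qed.

Lemma cvg_near_time (f g : R -> R) :
  (forall t, 0 < t -> (t%:E < T)%E -> f t = g t) ->
  cvg (g t @[t --> 0^'+]) -> cvg (f t @[t --> 0^'+]).
Proof.
move=> fg /cvg_ex[l gl]; apply/cvg_ex; exists l; apply: cvg_trans gl.
apply: near_eq_cvg; apply: filterS near_time => t [t0 tT]; exact/esym/fg.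
Qed.

Let goodD f g : good f -> good g -> good (fun x => f x + g x).
Proof.
move=> [cf lf] [cg lg]; split; first exact: Cc0D.
apply: (@cvg_near_time _ (fun t => mass w f t + mass w g t)).
  by move=> t t0 tT; rewrite (massD oO cw).
exact: (is_cvgD lf lg).
Qed.

Let goodZ a f : good f -> good (fun x => a * f x).
Proof.
move=> [cf lf]; split; first exact: Cc0Z.
apply: (@cvg_near_time _ (fun t => a * mass w f t)).
  by move=> t t0 tT; rewrite (massZ oO cw).
by apply: is_cvgM; [exact: is_cvg_cst|exact: lf].
Qed.

Let good0 : good (fun=> 0).
Proof.
split; first exact: Cc0_cst0.
rewrite (_ : (fun t => _) = fun=> 0); first exact: is_cvg_cst.
apply/funext => t; rewrite /mass /Rintegral integral0_eq //.
by move=> x _; rewrite mulr0.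
Qed.

Let good_sum (I : finType) (P : pred I) (F : I -> 'rV[R]_N -> R) :
  (forall i, P i -> good (F i)) -> good (fun x => \sum_(i | P i) F i x).
Proof.
move=> gF; elim: (index_enum I) => [|i s IH].
  rewrite [X in good X](_ : _ = fun=> 0); first exact: good0.
  by apply/funext => x; rewrite big_nil.
have [Pi|Pi] := boolP (P i).
  rewrite [X in good X](_ : _ = fun x => F i x + \sum_(j <- s | P j) F j x).
    exact: (goodD (gF i Pi) IH).
  by apply/funext => x; rewrite big_cons Pi.
rewrite [X in good X](_ : _ = fun x => \sum_(j <- s | P j) F j x) //.
by apply/funext => x; rewrite big_cons (negbTE Pi).
Qed.

(** Weighted masses are controlled by the mass of one fixed plateau function,
    so that uniform approximation by sums of small smooth bumps transfers the
    Cauchy property. *)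
Lemma mass_limit_Cc0 psi :
  (forall x, RR x -> exists2 r : R, 0 < r & forall phi,
     test_function (ball x r) phi -> cvg (mass w phi t @[t --> 0^'+])) ->
  Cc0 RR psi -> cvg (mass w psi t @[t --> 0^'+]).
Proof.
move=> loc cpsi; have [cp [kp sp]] := cpsi.
set K := closure _ in kp sp.
have [h0 h00 Hh0] : exists2 h : R, 0 < h & forall y, K y ->
    (fun A : set 'rV[R]_N => A `<=` RR /\ forall phi, test_function A phi ->
      cvg (mass w phi t @[t --> 0^'+])) (ball y h).
  apply: (lebesgue_number (P := fun A => A `<=` RR /\ forall phi,
    test_function A phi -> cvg (mass w phi t @[t --> 0^'+]))) => //.
    move=> A B AB [BR HB]; split; first exact: subset_trans BR.
    by move=> phi tA; apply: HB; exact: test_function_sub tA.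
  move=> x /sp RRx; have [r r0 Hr] := loc x RRx.
  have : nbhs x RR by exact: open_nbhs_nbhs.
  rewrite -nbhs_ballE => -[e /= e0 eR]; exists (Num.min r e).
    by rewrite lt_min r0.
  split.
    by apply: subset_trans eR; apply: le_ball; rewrite ge_min lexx orbT.
  move=> phi tp; apply: Hr; apply: test_function_sub tp; apply: le_ball.
  by rewrite ge_min lexx.
have goodK y theta : K y -> test_function (ball y h0) theta -> good theta.
  move=> /Hh0 [bR HR] tt; split; last exact: HR.
  by apply: Cc0_sub (test_function_Cc0 tt); exact: subset_trans RO.
have [I [P [theta [t0 tK t1 [h h0' th]]]]] := smooth_cutoff_sum kp h00.
pose chi x := \sum_(i | P i) theta i x.
have gchi : good chi by apply: good_sum => i /tK[y Ky]; exact: goodK.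
have [cchi lchi] := gchi.
have cpsiO : Cc0 Omega psi := Cc0_sub RO cpsi.
pose L := lim (mass w chi t @[t --> 0^'+]).
apply: cauchy_cvg; apply: cauchy_exP => e e0.
have d0 : 0 < e / 2 / (`|L| + 1) by rewrite !divr_gt0 // ltr_wpDl.
set d := e / 2 / _ in d0.
have m0 : 0 < Num.min h h0 by rewrite lt_min h0' h00.
have [J [Q [a [eta [etaK [etad etas]]]]]] := smooth_approx cpsi d0 m0.
pose S x := \sum_(i | Q i) a i * eta i x.
have gS : good S.
  apply: good_sum => i /etaK[y Ky tb]; apply: goodZ; apply: (goodK y) => //.
  by apply: test_function_sub tb; apply: le_ball; rewrite ge_min lexx orbT.
have [cS lS] := gS.
have psiS x : `|psi x - S x| <= d * chi x.
  have [[p0 s0]|ps] : (psi x = 0 /\ S x = 0) \/ (psi x != 0 \/ S x != 0).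
    have [->|] := eqVneq (psi x) 0; last by move=> ?; right; left.
    by have [->|] := eqVneq (S x) 0; [left|move=> ?; right; right].
    rewrite p0 s0 subrr normr0 mulr_ge0 ?(ltW d0) //; exact: sumr_ge0.
  have [y Ky xy] := etas x ps; rewrite /chi (th x y) ?mulr1 //.
  by apply: le_trans xy _; rewrite ge_min lexx.
pose l : R := lim (mass w S t @[t --> 0^'+]); exists l.
rewrite /= -ball_normE /=.
have cdchi := Cc0Z d cchi.
near=> t.
have [t_0 tT] : 0 < t /\ (t%:E < T)%E by near: t; exact: near_time.
have H1 : `|l - mass w S t| < e / 2.
  by near: t; move/cvgrPdist_lt : lS; apply; rewrite divr_gt0.
have H2 : mass w chi t < `|L| + 1.
  have : `|L - mass w chi t| < 1 by near: t; move/cvgrPdist_lt : lchi; apply.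
  by rewrite ltr_norml => /andP[+ _]; have := ler_norm L; lra.
have dH2 : d * mass w chi t < e / 2.
  apply: lt_le_trans (_ : d * (`|L| + 1) <= _); first by rewrite ltr_pM2l.
  by rewrite /d divfK // gt_eqF // ltr_wpDl.
have H3 : mass w psi t <= mass w S t + d * mass w chi t.
  rewrite -(massZ oO cw d cchi) // -(massD oO cw cS cdchi) //.
  apply: (le_mass oO cw) => //; first exact: Cc0D.
  by move=> x; have := psiS x; rewrite ler_norml => /andP[_]; lra.
have H4 : mass w S t <= mass w psi t + d * mass w chi t.
  rewrite -(massZ oO cw d cchi) // -(massD oO cw cpsiO cdchi) //.
  apply: (le_mass oO cw) => //; first exact: Cc0D.
  by move=> x; have := psiS x; rewrite ler_norml => /andP[+ _]; lra.
move: H1; rewrite ltr_norml => /andP[H1 H1'].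
rewrite /= ltr_norml; apply/andP; split; lra.
Unshelve. all: by end_near. Qed.

End extension.

(** * Riesz representation *)

Section riesz.
Context {R : realType} {N : nat}.
Variables (U : set 'rV[R]_N) (L : ('rV[R]_N -> R) -> R).
Hypothesis oU : open U.
Hypothesis LD : forall f g, Cc0 U f -> Cc0 U g ->
  L (fun x => f x + g x) = L f + L g.
Hypothesis LZ : forall a f, Cc0 U f -> L (fun x => a * f x) = a * L f.
Hypothesis L_le : forall f g, Cc0 U f -> Cc0 U g -> (forall x, f x <= g x) ->
  L f <= L g.
Implicit Types (V W K A : set 'rV[R]_N) (f g : 'rV[R]_N -> R).
Local Open Scope ereal_scope.

Let below V f := Cc0 V f /\ forall x, (0 <= f x <= 1)%R.

(** As in the Riesz-Markov theorem, open sets are measured from inside by the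
    functional and arbitrary sets from outside by open sets. Points outside [U]
    are disregarded, so that the complement of [U] becomes a null set. *)
Definition open_content V : \bar R :=
  ereal_sup [set (L f)%:E | f in [set f | below V f]].

Definition riesz_outer A : \bar R :=
  ereal_inf [set open_content V | V in
    [set V | open V /\ V `<=` U /\ A `&` U `<=` V]].

Lemma functional0 : L (fun=> 0%R) = 0%R.
Proof.
rewrite -[RHS](mul0r (L (fun=> 0%R))) -LZ; last exact: Cc0_cst0.
by congr L; apply/funext => x; rewrite mulr0.
Qed.

Lemma below0 V : below V (fun=> 0%R).
Proof. by split=> [|x]; [exact: Cc0_cst0|rewrite lexx ler01]. Qed.

Lemma content_ge V f : below V f -> (L f)%:E <= open_content V.
Proof. by move=> bf; apply: ereal_sup_ubound; exists f. Qed.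

Lemma content_ge0 V : 0 <= open_content V.
Proof. by have := content_ge (below0 V); rewrite functional0. Qed.

Lemma content_le V W : V `<=` W -> open_content V <= open_content W.
Proof.
move=> VW; apply: ereal_sup_le => _ [f [cf f01] <-]; exists f => //.
by split => //; exact: Cc0_sub cf.
Qed.

Lemma content0 : open_content set0 = 0.
Proof.
apply/eqP; rewrite eq_le content_ge0 andbT;
  apply: ge_ereal_sup => _ [f [cf _] <-].
rewrite (_ : f = fun=> 0%R) ?functional0 //; apply/funext => x;
  apply: contrapT => /eqP fx.
by have [_ [_]] := cf; apply;
  exact: (@subset_closure _ [set x | f x != 0%R] x fx).
Qed.

(** A function below the union splits along a cutoff that equals 1 near the
    part of its support that [W] misses. *)
Lemma contentU V W : open V -> open W -> V `<=` U -> W `<=` U ->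
  open_content (V `|` W) <= open_content V + open_content W.
Proof.
move=> oV oW VU WU; apply: ge_ereal_sup => _ [f [cf f01] <-].
have [cof [kf sf]] := cf; set K := closure _ in kf sf.
have fK x : f x != 0%R -> K x by move=> fx; exact: subset_closure.
pose K1 := K `&` ~` W.
have kK1 : compact K1.
  apply: (subclosed_compact _ kf); last by move=> x [].
  by apply: closedI; [exact: closed_closure|exact: open_closedC].
have K1V : K1 `<=` V by move=> x [/sf[]].
have [chi [h [[schi schi'] chi01 h0 chi1]]] := smooth_cutoff kK1 oV K1V.
have cchi := smooth_continuous schi.
pose f1 x := (chi x * f x)%R.
pose f2 x := ((1 - chi x) * f x)%R.
have b1 : below V f1.
  split; last first.
    move=> x; have /andP[a b] := f01 x; have /andP[c d] := chi01 x.
    by rewrite mulr_ge0 //= mulr_ile1.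
  split; first by move=> x; apply: continuousM; [exact: cchi|exact: cof].
  by apply: compact_support_hull schi' _ => x cx; rewrite /f1 cx mul0r.
have f2K x : closure [set x | f2 x != 0%R] x -> K x.
  apply: closureS => y /=; apply: contra_neq => fy; by rewrite /f2 fy mulr0.
have b2 : below W f2.
  split; last first.
    move=> x; have /andP[a b] := f01 x; have /andP[c d] := chi01 x.
    by rewrite mulr_ge0 ?subr_ge0 //= mulr_ile1 // ?subr_ge0 // gerBl.
  split.
    move=> x; apply: (@continuousM _ _ (fun x => 1 - chi x)%R f);
      last exact: cof.
    by apply: continuousB; [exact: cst_continuous|exact: cchi].
  split; first by apply: (subclosed_compact _ kf) => //; exact: closed_closure.
  move=> x fx; apply: contrapT => Wx; have Kx := f2K x fx.
  have [y /= [f2y xy]] := fx _ (nbhsx_ballx x _ h0).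
  move/negP: f2y; apply; apply/eqP; rewrite /f2 (chi1 y x) ?subrr ?mul0r //.
  by move: xy; rewrite ball_rVE distrC => /ltW.
have -> : L f = (L f1 + L f2)%R.
  rewrite -LD; [|exact: Cc0_sub b1.1|exact: Cc0_sub b2.1].
  by congr L; apply/funext => x; rewrite /f1 /f2; ring.
by rewrite EFinD; apply: leeD; exact: content_ge.
Qed.

Lemma content_bigcup (V : nat -> set 'rV[R]_N) :
  (forall i, open (V i)) -> (forall i, V i `<=` U) ->
  open_content (\bigcup_i V i) <= \sum_(i <oo) open_content (V i).
Proof.
move=> oV VU; pose W n := [set x | exists2 i, (i < n)%N & V i x].
have WS n : W n.+1 = W n `|` V n.
  apply/seteqP; split => x.
    move=> [i]; rewrite ltnS leq_eqVlt => /predU1P[->|it] Vx; first by right.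
    by left; exists i.
  by move=> [[i it Vx]|Vx]; [exists i => //; exact: ltnW|exists n].
have oW n : open (W n).
  elim: n => [|n IH]; last by rewrite WS; exact: openU.
  by rewrite (_ : W 0%N = set0) ?open0 //; apply/seteqP; split => // x [].
have WU n : W n `<=` U by move=> x [i _ /VU].
have lW n : open_content (W n) <= \sum_(0 <= i < n) open_content (V i).
  elim: n => [|n IH].
    rewrite big_geq // (_ : W 0%N = set0) ?content0 //.
    by apply/seteqP; split => // x [].
  rewrite WS big_nat_recr //=;
    apply: le_trans (contentU (oW n) (oV n) (WU n) _) _.
    exact: VU.
  exact: leeD2r.
apply: ge_ereal_sup => _ [f [[cf [kf sf]] f01] <-].
have [n fW] : exists n, closure [set x | f x != 0%R] `<=` W n.
  move: kf => /compact_near_coveringP /(_ nat \oo (fun n x => W n x)).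
  have F : Filter \oo by exact: eventually_filter.
  move=> /(_ F) [x /sf [i _ Vi]|n _ H].
    have oVx : nbhs x (V i) by exact: open_nbhs_nbhs.
    exists (V i, [set n | (i < n)%N]).
      by split => //=; exact: nbhs_infty_gt.
    by move=> [y n] [/= Vy ltin]; exists i.
  by exists n; apply: H => /=.
apply: le_trans (_ : open_content (W n) <= _); first by apply: content_ge.
apply: le_trans (lW n) _; apply: nneseries_lim_ge => i _ _; exact: content_ge0.
Qed.

Lemma riesz_outer_open V : open V -> V `<=` U -> riesz_outer V = open_content V.
Proof.
move=> oV VU; apply/eqP; rewrite eq_le; apply/andP; split.
  by apply: ereal_inf_lbound; exists V => //; split => //; split => // x [].
apply: le_ereal_inf_tmp => _ [W [oW [WU VW]] <-]; apply: content_le => x Vx.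
by apply: VW; split => //; exact: VU.
Qed.

Lemma riesz_outer_ge0 A : 0 <= riesz_outer A.
Proof. by apply: le_ereal_inf_tmp => _ [W _ <-]; exact: content_ge0. Qed.

Lemma riesz_outer0 : riesz_outer set0 = 0.
Proof. by rewrite riesz_outer_open ?content0 //; exact: open0. Qed.

Lemma riesz_outer_le A V : open V -> V `<=` U -> A `&` U `<=` V ->
  riesz_outer A <= open_content V.
Proof. by move=> oV VU AV; apply: ereal_inf_lbound; exists V. Qed.

Lemma le_riesz_outer : {homo riesz_outer : A B / A `<=` B >-> A <= B}.
Proof.
move=> A B AB; apply: le_ereal_inf_tmp => _ [W [oW [WU BW]] <-].
by apply: riesz_outer_le => // x [Ax Ux]; apply: BW; split => //; exact: AB.
Qed.

Lemma riesz_outer_sigma : sigma_subadditive riesz_outer.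
Proof.
move=> F; apply/lee_addgt0Pr => e e0.
have /choice[V VP] i : exists V, open V /\ V `<=` U /\ F i `&` U `<=` V /\
    open_content V <= riesz_outer (F i) + (e / (2 ^ i.+1)%:R)%:E.
  have [Foo|Foo] := eqVneq (riesz_outer (F i)) +oo.
    by exists U; split => //; split => //; split => [x []//|]; rewrite Foo leey.
  have fin : riesz_outer (F i) \is a fin_num.
    by rewrite ge0_fin_numE ?riesz_outer_ge0 // lt_neqAle Foo leey.
  have ei : (0 < e / (2 ^ i.+1)%:R)%R by rewrite divr_gt0 // ltr0n expn_gt0.
  have [_ [V [oV [VU FV]] <-] VL] := lb_ereal_inf_adherent ei fin.
  by exists V; split => //; split => //; split => //; exact: ltW.
apply: le_trans (epsilon_trick xpredT (fun i => riesz_outer_ge0 (F i))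
  (ltW e0)).
apply: (@le_trans _ _ (\sum_(i <oo) open_content (V i))); last first.
  apply: lee_nneseries => i _; first by move=> _; exact: content_ge0.
  by have [_ [_ [_]]] := VP i.
apply: le_trans (content_bigcup _ _); last 2 first.
- by move=> i; case: (VP i).
- by move=> i; case: (VP i) => _ [].
apply: riesz_outer_le.
- by apply: bigcup_open => i _; case: (VP i).
- by move=> x [i _]; case: (VP i) => _ [+ _]; apply.
- move=> x [[i _ Fx] Ux]; exists i => //.
  by case: (VP i) => _ [_ [+ _]]; apply.
Qed.

Let mo : {outer_measure set 'rV[R]_N -> \bar R} :=
  HB.pack riesz_outer (isOuterMeasure.Build R 'rV[R]_N riesz_outer
    riesz_outer0 riesz_outer_ge0 le_riesz_outer riesz_outer_sigma).

(** A competitor [f] for [V `&` E] and a competitor [g] for [V] minus the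
    support of [f] have disjoint supports, so [f + g] is a competitor for [V]. *)
Lemma open_caratheodory E : open E -> mo.-caratheodory E.
Proof.
move=> oE; apply: le_caratheodory_measurable => X /=.
apply: le_ereal_inf_tmp => _ [V [oV [VU XV]] <-].
have [->|Voo] := eqVneq (open_content V) +oo; first by rewrite leey.
have fin B : B <= open_content V -> 0 <= B -> B \is a fin_num.
  by move=> BV B0; rewrite ge0_fin_numE // (le_lt_trans BV) // lt_neqAle
    Voo leey.
have sub_fin : riesz_outer (X `&` ~` E) \is a fin_num.
  apply: fin; last exact: riesz_outer_ge0.
  by apply: riesz_outer_le => // x [[Xx _] Ux]; apply: XV.
apply: (@le_trans _ _ (open_content (V `&` E) + riesz_outer (X `&` ~` E))).
  apply: leeD2r; apply: riesz_outer_le.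
  - exact: openI.
  - by move=> x [/VU].
  - by move=> x [[Xx Ex] Ux]; split => //; apply: XV.
rewrite -leeBrDr //; apply: ge_ereal_sup => _ [f [cf f01] <-].
rewrite leeBrDr //; have [cof [kf sf]] := cf; set K := closure _ in kf sf.
pose W := V `&` ~` K.
have oW : open W by apply: openI => //; exact/closed_openC/closed_closure.
have WU : W `<=` U by move=> x [/VU].
apply: (@le_trans _ _ ((L f)%:E + open_content W)).
  apply: leeD2l; apply: riesz_outer_le => // x [[Xx Ex] Ux]; split;
    first exact: XV.
  by move=> /sf [].
have Wfin : open_content W \is a fin_num.
  by apply: fin; [apply: content_le => x []|exact: content_ge0].
rewrite addeC -leeBrDr //; apply: ge_ereal_sup => _ [g [cg g01] <-].
rewrite leeBrDr // addeC -EFinD -LD; last 2 first.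
- by apply: Cc0_sub cf => x [/VU].
- by apply: Cc0_sub cg.
apply: content_ge; split.
  by apply: Cc0D; [apply: Cc0_sub cf => x []|apply: Cc0_sub cg => x []].
move=> x; have /andP[f0 f1] := f01 x; have /andP[g0 g1] := g01 x.
rewrite addr_ge0 //=; have [->|fx] := eqVneq (f x) 0%R; first by rewrite add0r.
have -> : g x = 0%R; last by rewrite addr0.
apply: contrapT => /eqP gx; have [_ [_ sg]] := cg.
have : W x by apply: sg; exact: (@subset_closure _ [set x | g x != 0%R] x gx).
by case=> _; apply; exact: subset_closure.
Qed.

Lemma borel_caratheodory A : measurable A -> mo.-caratheodory A.
Proof.
move=> mA; suff : <<s @open 'rV[R]_N >> `<=` mo.-cara.-measurable by apply;
  exact: mA.
apply: smallest_sub; last by move=> E /open_caratheodory.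
split; first exact: caratheodory_measurable_set0.
  by move=> B mB; rewrite setTD; exact: caratheodory_measurable_setC.
exact: caratheodory_measurable_bigcup.
Qed.

Lemma riesz_semi_sigma_additive :
  semi_sigma_additive (riesz_outer : set 'rV[R]_N -> \bar R).
Proof.
move=> F mF tF mUF.
apply: (@caratheodory_measure_sigma_additive _ _ mo F) => //.
  by move=> i; exact: borel_caratheodory.
exact: borel_caratheodory.
Qed.

Definition riesz_measure : {measure set 'rV[R]_N -> \bar R} :=
  HB.pack riesz_outer (isMeasure.Build _ 'rV[R]_N R riesz_outer
    riesz_outer0 riesz_outer_ge0 riesz_semi_sigma_additive).

Lemma riesz_outer_ge_supp f K : Cc0 U f -> (forall x, 0 <= f x <= 1)%R ->
  closure [set x | f x != 0%R] `<=` K -> K `<=` U -> (L f)%:E <= riesz_outer K.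
Proof.
move=> [cf [kf sf]] f01 fK KU.
apply: le_ereal_inf_tmp => _ [W [oW [WU KW]] <-].
by apply: content_ge; split => //; split => //; split => // x /fK Kx; apply: KW;
  split => //; exact: KU.
Qed.

(** On the open set where [f] exceeds [c^-1], with [c > 1] close to 1, any
    competitor is at most [c * f]. *)
Lemma riesz_outer_le_level f K : Cc0 U f -> (forall x, 0 <= f x)%R ->
  K `<=` U -> (forall x, K x -> 1 <= f x)%R -> riesz_outer K <= (L f)%:E.
Proof.
move=> cf f0 KU f1.
have Lf0 : (0 <= L f)%R by rewrite -functional0; apply: L_le => //;
  exact: Cc0_cst0.
apply/lee_addgt0Pr => e e0; rewrite -EFinD.
pose c := (1 + e / (L f + 1))%R.
have Lf1 : (0 < L f + 1)%R by rewrite ltr_wpDl.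
have c1 : (1 < c)%R by rewrite ltrDl divr_gt0.
have cL : (c * L f <= L f + e)%R.
  rewrite mulrDl mul1r lerD2l mulrAC ler_pdivrMr // ler_wpM2l ?(ltW e0) //.
  by rewrite lerDl.
pose W := [set x | c^-1 < f x]%R.
have oW : open W.
  rewrite (_ : W = f @^-1` [set y | c^-1 < y]%R) //; apply: open_comp => //.
  by move=> x _; exact: cf.1.
have WU : W `<=` U.
  move=> x Wx; have [_ [_]] := cf; apply.
  apply: (@subset_closure _ [set x | f x != 0%R] x) => /=.
  by rewrite gt_eqF // (lt_trans _ Wx) // invr_gt0 (lt_trans ltr01).
apply: (@le_trans _ _ (open_content W)).
  apply: riesz_outer_le => // x [Kx _]; rewrite /W /=.
  by apply: lt_le_trans (f1 x Kx); rewrite invf_lt1 // (lt_trans ltr01).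
apply: ge_ereal_sup => _ [g [cg g01] <-]; rewrite lee_fin; apply: le_trans cL.
rewrite -LZ //; apply: L_le; first exact: Cc0_sub cg.
  exact: Cc0Z.
move=> x; have [->|gx] := eqVneq (g x) 0%R.
  by rewrite mulr_ge0 // (le_trans ler01) // ltW.
have /andP[_ g1] := g01 x; apply: le_trans g1 _.
have Wx : W x by have [_ [_]] := cg; apply; exact: subset_closure.
by rewrite -ler_pdivrMl ?(lt_trans ltr01 c1) // mulr1 ltW.
Qed.

Lemma riesz_outer_compact K : compact K -> K `<=` U -> riesz_outer K < +oo.
Proof.
move=> cK KU; have [chi [h [tchi chi01 h0 chi1]]] := smooth_cutoff cK oU KU.
apply: le_lt_trans (ltry (L chi)); apply: riesz_outer_le_level => //.
- exact: test_function_Cc0.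
- by move=> x; have /andP[] := chi01 x.
- by move=> x Kx; rewrite (chi1 x x) // subrr normr0 ltW.
Qed.

Lemma riesz_radon : radon_on U riesz_measure.
Proof.
split.
- apply/eqP; rewrite eq_le [X in _ && X]riesz_outer_ge0 andbT.
  rewrite -[leRHS]content0; apply: riesz_outer_le; first exact: open0.
    by [].
  by move=> x [].
- exact: riesz_outer_compact.
- move=> A mA AU; apply/eqP; rewrite eq_le; apply/andP; split.
    apply: le_ereal_inf_tmp => _ [V [oV [AV VU]] <-]; exact: le_riesz_outer.
  apply: le_ereal_inf_tmp => _ [V [oV [VU AV]] <-].
  rewrite -riesz_outer_open //; apply: ereal_inf_lbound; exists V => //.
  by split => //; split => // x Ax; apply: AV; split => //; exact: AU.
- move=> V oV VU; apply/eqP; rewrite eq_le; apply/andP; split; last first.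
    by apply: ge_ereal_sup => _ [K [cK KV] <-]; exact: le_riesz_outer.
  rewrite [leLHS](riesz_outer_open oV VU).
  apply: ge_ereal_sup => _ [f [cf f01] <-].
  apply: (@le_trans _ _ (riesz_outer (closure [set x | f x != 0%R]))).
    apply: riesz_outer_ge_supp => //; first exact: Cc0_sub cf.
    by have [_ [_ sf]] := cf; exact: subset_trans VU.
  apply: ereal_sup_ubound; exists (closure [set x | f x != 0%R]) => //.
  by have [_ []] := cf.
Qed.

Let cont_integrable f : Cc0 U f -> riesz_measure.-integrable setT (EFin \o f).
Proof.
move=> [cf [kf sf]]; apply: (continuous_integrable kf _ cf).
  exact: riesz_outer_compact.
by move=> x fx; exact: subset_closure.
Qed.

Let I f : R := (\int[riesz_measure]_x f x)%R.
Let m f : R := fine (riesz_outer (closure [set x | f x != 0%R])).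

Let supp_fin f : Cc0 U f ->
  riesz_outer (closure [set x | f x != 0%R]) = (m f)%:E.
Proof.
move=> [_ [kf sf]]; rewrite fineK // ge0_fin_numE ?riesz_outer_ge0 //.
exact: riesz_outer_compact.
Qed.

Let integral_supp f (e : R) : Cc0 U f ->
  riesz_measure.-integrable setT
    (EFin \o (fun x => e * \1_(closure [set x | f x != 0%R]) x)%R) /\
  (\int[riesz_measure]_x (e * \1_(closure [set x | f x != 0%R]) x))%R =
    (e * m f)%R.
Proof.
move=> cf; have [_ [kf sf]] := cf; set S := closure _ in kf sf *.
have mS : measurable S by exact: measurable_compact_rV.
have iS : riesz_measure.-integrable setT (EFin \o \1_S).
  by apply: integrable_indic_lty => //; exact: riesz_outer_compact.
split.
  rewrite (_ : _ \o _ = fun x => e%:E * (\1_S x)%:E) //; exact: integrableZl.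
rewrite (RintegralZl _ measurableT iS); congr (_ * _)%R.
by rewrite /Rintegral integral_indic // setIT.
Qed.

(** Slicing [f] at height [e]: the slice below the level lies between [e] times
    the indicators of the supports of the remainder and of [f], both for the
    functional and for the integral, so that the errors telescope. *)
Lemma riesz_layer (e : R) n f : (0 < e)%R -> Cc0 U f ->
  (forall x, 0 <= f x)%R ->
  (forall x, f x <= n%:R * e)%R ->
  (L f <= I f + e * m f)%R /\ (I f <= L f + e * m f)%R.
Proof.
move=> e0; elim: n f => [|n IH] f cf f0 fn.
  have -> : f = fun=> 0%R.
    by apply/funext => x; apply/eqP;
      rewrite eq_le f0 andbT (le_trans (fn x)) // mul0r.
  have -> : I (fun=> 0%R) = 0%R by rewrite /I /Rintegral integral0_eq.
  rewrite functional0 add0r; have : (0 <= e * m (fun=> 0))%R; last by [].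
  by rewrite mulr_ge0 ?(ltW e0) // fine_ge0 // riesz_outer_ge0.
pose f1 x := Num.min (f x) e; pose f2 x := Num.max (f x - e)%R 0%R.
have f12 x : (f x = f1 x + f2 x)%R.
  by rewrite /f1 /f2; case: leP => h1; case: leP => h2; lra.
have f10 x : (0 <= f1 x <= e)%R.
  by rewrite le_min f0 (ltW e0) ge_min lexx orbT.
have f20 x : (0 <= f2 x)%R by rewrite le_max lexx orbT.
have cf1 : Cc0 U f1.
  split; first by move=> x; apply: continuous_min;
    [exact: cf.1|exact: cst_continuous].
  by apply: compact_support_hull cf.2 _ => x fx; rewrite /f1 fx min_l // ltW.
have cf2 : Cc0 U f2.
  split.
    move=> x; apply: (@continuous_max _ _ (fun x => f x - e)%R (fun=> 0%R)).
      by apply: continuousB; [exact: cf.1|exact: cst_continuous].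
    exact: cst_continuous.
  apply: compact_support_hull cf.2 _ => x fx; rewrite /f2 fx max_r //; lra.
have [H1 H2] : (L f2 <= I f2 + e * m f2)%R /\ (I f2 <= L f2 + e * m f2)%R.
  apply: IH => // x; rewrite ge_max mulr_ge0 ?(ltW e0) // andbT.
  by have := fn x; rewrite -natr1; lra.
have S2 x : closure [set x | f2 x != 0%R] x -> (e <= f x)%R.
  have : closed [set x | e <= f x]%R.
    rewrite (_ : mkset _ = f @^-1` [set y | e <= y]%R) //; apply: closed_comp.
      by move=> y _; exact: cf.1.
    exact: closed_ge.
  move=> cl; suff : closure [set x | f2 x != 0%R] `<=` [set x | e <= f x]%R
    by apply.
  rewrite closureE; apply: smallest_sub => // y /=; apply: contraR => fe.
  by rewrite /f2 max_r // subr_le0 ltW // ltNge.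
have f1e x : closure [set x | f2 x != 0%R] x -> f1 x = e.
  by move=> /S2 fe; rewrite /f1 min_r.
have cf1' := Cc0Z e^-1 cf1.
have L1 : (L f1 <= e * m f)%R.
  rewrite -ler_pdivrMl // -LZ // -lee_fin -supp_fin //.
  apply: riesz_outer_ge_supp => //; last by case: cf => _ [].
    move=> x; have /andP[a b] := f10 x.
    by rewrite mulr_ge0 ?invr_ge0 ?(ltW e0) //= ler_pdivrMl // mulr1.
  apply: closureS => x /=; apply: contra_neq => fx.
  by rewrite /f1 fx min_l ?mulr0 // ltW.
have L2 : (e * m f2 <= L f1)%R.
  rewrite -ler_pdivlMl // -LZ // -lee_fin -supp_fin //.
  apply: riesz_outer_le_level => //.
  - by move=> x; have /andP[a b] := f10 x; rewrite mulr_ge0 ?invr_ge0 ?(ltW e0).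
  - by case: cf2 => _ [].
  - by move=> x /f1e ->; rewrite mulVf // gt_eqF.
have [i1 E1] := integral_supp e cf.
have [i2 E2] := integral_supp e cf2.
have I1 : (I f1 <= e * m f)%R.
  rewrite -E1; apply: (le_Rintegral measurableT (cont_integrable cf1)
    i1) => x _.
  have /andP[a b] := f10 x; rewrite indicE; case: (boolP (x \in _)) => xS.
    by rewrite mulr1.
  have [fx|fx] := eqVneq (f x) 0%R; first by rewrite /f1 fx min_l ?mulr0 // ltW.
  by move/negP : xS; case; apply/mem_set/(@subset_closure _
    [set x | f x != 0%R]).
have I2 : (e * m f2 <= I f1)%R.
  rewrite -E2; apply: (le_Rintegral measurableT i2
    (cont_integrable cf1)) => x _.
  have /andP[a b] := f10 x; rewrite indicE; case: (boolP (x \in _)) => xS.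
    by rewrite mulr1 f1e //; exact: set_mem.
  by rewrite mulr0.
have fE : f = fun x => (f1 x + f2 x)%R by apply/funext => x; exact: f12.
have LE : L f = (L f1 + L f2)%R by rewrite {1}fE LD.
have IE : I f = (I f1 + I f2)%R.
  rewrite {1}fE.
  exact: (RintegralD measurableT (cont_integrable cf1) (cont_integrable cf2)).
by rewrite LE IE; split; lra.
Qed.

Let riesz_ge0 f : Cc0 U f -> (forall x, 0 <= f x)%R -> I f = L f.
Proof.
move=> cf f0; have [M M0 fM] := Cc0_bounded cf.
have m0 : (0 <= m f)%R by rewrite fine_ge0 // riesz_outer_ge0.
have H d : (0 < d)%R -> (L f <= I f + d)%R /\ (I f <= L f + d)%R.
  move=> d0; pose e := (d / (m f + 1))%R.
  have m1 : (0 < m f + 1)%R by rewrite ltr_wpDl.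
  have e0 : (0 < e)%R by rewrite divr_gt0.
  have em : (e * m f <= d)%R.
    by rewrite /e mulrAC ler_pdivrMr // ler_wpM2l ?(ltW d0) // lerDl.
  have fn x : (f x <= (Num.truncn (M / e)).+1%:R * e)%R.
    apply: le_trans (ler_norm _) _; apply: le_trans (fM x) _.
    by rewrite -ler_pdivrMr // ltW // truncnS_gt.
  by have [h1 h2] := riesz_layer e0 cf f0 fn; split; lra.
by apply/eqP; rewrite eq_le; apply/andP; split; apply/ler_addgt0Pr => d d0;
  have [] := H d d0.
Qed.

(** [riesz_layer] with small heights identifies the functional with the integral
    on nonnegative functions; the general case splits [f] into its positive and
    negative parts. *)
Lemma riesz_representation : exists mu : {measure set 'rV[R]_N -> \bar R},
  radon_on U mu /\
  forall f, Cc0 U f -> \int[mu]_(x in U) (f x)%:E = (L f)%:E.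
Proof.
exists riesz_measure; split; first exact: riesz_radon.
move=> f cf; have [cof [kf sf]] := cf.
pose fp x := Num.max (f x) 0%R; pose fm x := Num.max (- f x)%R 0%R.
have cp : Cc0 U fp.
  split; first by move=> x; apply: continuous_max;
    [exact: cof|exact: cst_continuous].
  by apply: compact_support_hull cf.2 _ => x fx; rewrite /fp fx maxxx.
have cm : Cc0 U fm.
  split.
    move=> x; apply: (@continuous_max _ _ (fun x => - f x)%R (fun=> 0%R)).
      by apply: continuousN; exact: cof.
    exact: cst_continuous.
  by apply: compact_support_hull cf.2 _ => x fx; rewrite /fm fx oppr0 maxxx.
have E x : (f x = fp x + (-1) * fm x)%R.
  by rewrite /fp /fm mulN1r; case: leP => h1; case: leP => h2; lra.
have fE : f = fun x => (fp x + (-1) * fm x)%R by apply/funext => x; exact: E.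
have Ep : I fp = L fp by apply: riesz_ge0 => // x; rewrite le_max lexx orbT.
have Em : I fm = L fm by apply: riesz_ge0 => // x; rewrite le_max lexx orbT.
have If : I f = L f.
  rewrite fE LD //; last exact: Cc0Z.
  rewrite LZ // /I (RintegralD measurableT (cont_integrable cp)
    (cont_integrable (Cc0Z (-1)%R cm))).
  rewrite (RintegralZl _ measurableT (cont_integrable cm)) -/(I fp) -/(I fm).
  by rewrite Ep Em.
rewrite -If /I /Rintegral fineK;
  last exact: (integrable_fin_num _ (cont_integrable cf)).
rewrite [LHS]integral_mkcond; apply: eq_integral => x _; rewrite patchE.
case: ifPn => // /negP Ux; congr EFin; apply/esym/eqP;
  apply: contrapT => /negP fx.
apply: Ux; apply/mem_set/sf; exact: (@subset_closure _ [set x | f x != 0%R]).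
Qed.

End riesz.

(** * The initial trace *)

Section trace.
Context {R : realType} {N : nat}.
Variables (Omega RR : set 'rV[R]_N) (T : \bar R) (w : 'rV[R]_N * R -> R).
Hypotheses (oO : open Omega) (oRR : open RR) (RO : RR `<=` Omega)
  (T0 : (0 < T)%E).
Hypothesis cw : forall z, cylinder Omega T z -> {for z, continuous w}.
Hypothesis w0 : forall z, cylinder Omega T z -> 0 <= w z.

Lemma initial_trace :
  (forall x, RR x -> exists2 r : R, 0 < r & forall phi,
     test_function (ball x r) phi -> cvg (mass w phi t @[t --> 0^'+])) ->
  exists mu : {measure set 'rV[R]_N -> \bar R}, radon_on RR mu /\
    forall psi, Cc0 RR psi ->
      (\int[lebesgue_rV N]_(x in RR) (w (x, t) * psi x)%:E)%E
        @[t --> 0^'+] --> (\int[mu]_(x in RR) (psi x)%:E)%E.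
Proof.
move=> loc; pose L f : R := lim (mass w f t @[t --> 0^'+]).
have cL f : Cc0 RR f -> mass w f t @[t --> 0^'+] --> L f.
  by move=> cf; exact: (mass_limit_Cc0 oO oRR RO T0 cw w0 loc cf).
have cO (f : 'rV[R]_N -> R) : Cc0 RR f -> Cc0 Omega f by move=> cf;
  exact: (Cc0_sub RO cf).
have lim_eq (f g : R -> R) (l : R) :
    (forall t, 0 < t -> (t%:E < T)%E -> f t = g t) ->
    g t @[t --> 0^'+] --> l -> lim (f t @[t --> 0^'+]) = l.
  move=> fg gl; apply/cvg_lim => //; apply: cvg_trans gl; apply: near_eq_cvg.
  by apply: filterS (near_time T0) => t [t0 tT]; exact/esym/fg.
have LD (f g : 'rV[R]_N -> R) : Cc0 RR f -> Cc0 RR g ->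
  L (fun x => f x + g x) = L f + L g.
  move=> cf cg; apply: (@lim_eq _ (fun t => mass w f t + mass w g t)).
    by move=> t t0 tT; rewrite (massD oO cw (cO _ cf) (cO _ cg)).
  by apply: cvgD; exact: cL.
have LZ a (f : 'rV[R]_N -> R) : Cc0 RR f -> L (fun x => a * f x) = a * L f.
  move=> cf; apply: (@lim_eq _ (fun t => a * mass w f t)).
    by move=> t t0 tT; rewrite (massZ oO cw a (cO _ cf)).
  by apply: cvgM; [exact: cvg_cst|exact: cL].
have L_le (f g : 'rV[R]_N -> R) : Cc0 RR f -> Cc0 RR g ->
  (forall x, f x <= g x) -> L f <= L g.
  move=> cf cg fg; apply: ler_lim.
  - by apply/cvg_ex; exists (L f); exact: cL.
  - by apply/cvg_ex; exists (L g); exact: cL.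
  - apply: filterS (near_time T0) => t [t0 tT].
    exact: (le_mass oO cw w0 (cO _ cf) (cO _ cg)).
have [mu [rmu muL]] := riesz_representation oRR LD LZ L_le.
exists mu; split => // psi cpsi; rewrite muL //.
have : (mass w psi t)%:E @[t --> 0^'+] --> (L psi)%:E.
  by apply: cvg_EFin; [exact: nearW|exact: cL].
apply: cvg_trans; apply: near_eq_cvg.
apply: filterS (near_time T0) => t [t0 tT].
have iw := mass_integrable oO cw (cO _ cpsi) t0 tT.
rewrite /mass /Rintegral fineK; last exact: (integrable_fin_num _ iw).
rewrite [RHS]integral_mkcond; apply: eq_integral => x _; rewrite patchE.
case: ifPn => // /negP Ux; congr EFin.
have -> : psi x = 0; last by rewrite mulr0.
apply: contrapT => /eqP px; apply: Ux; apply/mem_set.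
by case: cpsi => _ [_]; apply; exact: subset_closure.
Qed.

End trace.

Theorem theorem1p2 (R : realType) (N : nat) (hN : (1 <= N)%N)
    (Omega : set 'rV[R]_N) (hOmega : domain Omega)
    (T : \bar R) (hT : (0 < T)%E) (p q : R) (hp : 1 < p) (hq : 1 < q)
    (u v : 'rV[R]_N * R -> R)
    (huv : positive_solution p q (cylinder Omega T) u v)
    (hu : smooth_on (cylinder Omega T) u)
    (hv : smooth_on (cylinder Omega T) v) :
  exists (RR SS : set 'rV[R]_N) (mu1 mu2 : {measure set 'rV[R]_N -> \bar R}),
    [/\ RR `&` SS = set0,
        RR `|` SS = Omega,
        open RR,
        radon_on RR mu1 /\ radon_on RR mu2 &
        (forall psi : 'rV[R]_N -> R, Cc0 RR psi ->
           (\int[lebesgue_rV N]_(x in RR) (u (x, t) * psi x)%:E)%E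
             @[t --> 0^'+] --> (\int[mu1]_(x in RR) (psi x)%:E)%E /\
           (\int[lebesgue_rV N]_(x in RR) (v (x, t) * psi x)%:E)%E
             @[t --> 0^'+] --> (\int[mu2]_(x in RR) (psi x)%:E)%E) /\
        (forall U : set 'rV[R]_N, open U -> U `<=` Omega ->
           U `&` SS !=set0 ->
           (\int[lebesgue_rV N]_(x in U) (u (x, t) + v (x, t))%:E)%E
             @[t --> 0^'+] --> +oo%E)].
Proof.
have oO : open Omega by case: hOmega.
have pair : heat_pair p q Omega T u v by [].
have [u_gt0 v_gt0 _ _ _] := huv.
pose blowup U := (\int[lebesgue_rV N]_(x in U) (u (x, t) + v (x, t))%:E)%E
  @[t --> 0^'+] --> +oo%E.
pose SS := [set x | Omega x /\
  forall U, open U -> U `<=` Omega -> U x -> blowup U].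
pose RR := Omega `&` ~` SS.
have RRP x : RR x -> exists U, [/\ open U, U `<=` Omega, U x & ~ blowup U].
  move=> [Ox nS]; apply: contrapT => nU; apply: nS; split => // U oU UO Ux.
  by apply: contrapT => nb; apply: nU; exists U.
have oRR : open RR.
  rewrite openE => x /RRP[U [oU UO Ux nb]]; apply: (@filterS _ (nbhs x) _ U).
    by move=> y Uy; split; [exact: UO|move=> [_ /(_ U oU UO Uy)]].
  exact: open_nbhs_nbhs.
have RO : RR `<=` Omega by move=> x [].
have [mu1 [rmu1 lim1]] : exists mu : {measure set 'rV[R]_N -> \bar R},
    radon_on RR mu /\ forall psi, Cc0 RR psi ->
      (\int[lebesgue_rV N]_(x in RR) (u (x, t) * psi x)%:E)%E
        @[t --> 0^'+] --> (\int[mu]_(x in RR) (psi x)%:E)%E.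
  apply: (initial_trace oO oRR RO hT (hu 0)) => [z /u_gt0/ltW //|x].
  by move=> /RRP[U [oU UO Ux nb]];
    exact: (regular_point_limit hp hq oO pair hT oU Ux UO nb).
have [mu2 [rmu2 lim2]] : exists mu : {measure set 'rV[R]_N -> \bar R},
    radon_on RR mu /\ forall psi, Cc0 RR psi ->
      (\int[lebesgue_rV N]_(x in RR) (v (x, t) * psi x)%:E)%E
        @[t --> 0^'+] --> (\int[mu]_(x in RR) (psi x)%:E)%E.
  apply: (initial_trace oO oRR RO hT (hv 0)) => [z /v_gt0/ltW //|x].
  move=> /RRP[U [oU UO Ux nb]].
  apply: (regular_point_limit hq hp oO (heat_pair_sym pair) hT oU Ux UO).
  by under eq_fun do under eq_integral do rewrite addrC.
exists RR, SS, mu1, mu2; split => //.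
- by apply/seteqP; split => // x [[_ nS] /nS].
- apply/seteqP; split => [x [[]|[]]//|x Ox].
  by have [Sx|nS] := pselect (SS x); [right|left].
- split=> [psi cpsi|U oU UO [x [Ux [Ox Sx]]]]; first by split;
  [exact: lim1|exact: lim2].
  exact: Sx.
Qed.
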